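(* Under the assumptions of Theorem 3 (asynchronous bandit unichain and strictly indexable; the unique fixed point $\mathbf m^*$ of the ODE $\dot{\mathbf m}=\tau(\phi(\mathbf m)-\mathbf m)$ is a uniform global attractor; $\mathbf m^*$ non-singular), let $\mathbf M^{(N)}(0)$ be distributed according to a stationary distribution of the continuous-time configuration Markov chain of the $N$-bandit asynchronous system under WIP ($\alpha N\in\mathbb N$). Then there exist constants $b,c>0$, independent of $N$, such that $\|\mathbb E[\mathbf M^{(N)}(0)]-\mathbf m^*\|\le b\,e^{-cN}$.
   Context: Asynchronous restless bandit model: $\mathbf Q^0,\mathbf Q^1$ are $d\times d$ generator matrices ($Q^a_{ij}\ge0$ for $i\neq j$, rows summing to $0$), $\alpha\in(0,1)$; $N$ bandits evolve in continuous time, independently given actions, bandit $n$ jumping from $i$ to $j\ne i$ at rate $Q^{a_n(t)}_{ij}$. Strict indexability (Whittle indices defined via the single-bandit subsidy-$\nu$ problem with extra passive reward $\nu$ per unit time; nested passive sets; distinct indices) with states labeled $\nu_1>\dots>\nu_d$; unichain: every policy gives a single recurrent class. WIP keeps active at all times the $\alpha N$ bandits with highest indices. $\mathbf M^{(N)}(t)\in\Delta^d=\{\mathbf m\in[0,1]^d:\sum m_i=1\}$ is the vector of fractions of bandits in each state. $\tau:=\max_i\max_a|Q^a_{ii}|$, $P^a_{ij}:=Q^a_{ij}/\tau$ for $i\ne j$, $P^a_{ii}:=1-\sum_{k\ne i}P^a_{ik}$. $s(\mathbf m)$ is the unique $s$ with $\sum_{i<s}m_i\le\alpha<\sum_{i\le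 s}m_i$; $\phi_j(\mathbf m)=\sum_{i=1}^{s(\mathbf m)-1} m_i P^1_{ij} + (\alpha-\sum_{i=1}^{s(\mathbf m)-1}m_i)P^1_{s(\mathbf m)j} + (\sum_{i=1}^{s(\mathbf m)}m_i - \alpha)P^0_{s(\mathbf m)j} + \sum_{i=s(\mathbf m)+1}^{d} m_i P^0_{ij}$, with unique fixed point $\mathbf m^*$ (which is the unique equilibrium of the ODE). Uniform global attractor: for every $\epsilon>0$ there is $T(\epsilon)$ such that the ODE solution $\Phi_t\mathbf m$ from any $\mathbf m\in\Delta^d$ satisfies $\|\Phi_t\mathbf m-\mathbf m^*\|\le\epsilon$ for $t\ge T(\epsilon)$. Singular: $\sum_{j\le i}m_j=\alpha$ for some $i$. $\|\cdot\|$ sup norm. *)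

(* Defs.v *)
From HB Require Import structures.
From mathcomp Require Import all_boot all_order all_algebra.
From mathcomp Require Import all_classical all_reals all_analysis.
Set Implicit Arguments. Unset Strict Implicit. Unset Printing Implicit Defensive.
Import Order.TTheory GRing.Theory Num.Theory.
Import numFieldNormedType.Exports.
Local Open Scope classical_set_scope.
Local Open Scope ring_scope.

Section Defs.
Variables (R : realType) (d : nat).

Definition generator (Q : 'M[R]_d) : Prop :=
  (forall i j : 'I_d, i != j -> 0 <= Q i j) /\ (forall i, \sum_j Q i j = 0).

(* Generator of the single bandit under action a (true = active). *)
Definition Qa (Q0 Q1 : 'M[R]_d) (a : bool) : 'M[R]_d := if a then Q1 else Q0.

Definition pol_rel (Q0 Q1 : 'M[R]_d) (pi : 'I_d -> bool) : rel 'I_d :=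
  fun i j => 0 < Qa Q0 Q1 (pi i) i j.

Definition recurrent (e : rel 'I_d) (i : 'I_d) : Prop :=
  forall j, connect e i j -> connect e j i.

Definition unichain (Q0 Q1 : 'M[R]_d) : Prop :=
  forall pi : 'I_d -> bool, forall i j : 'I_d,
    recurrent (pol_rel Q0 Q1 pi) i -> recurrent (pol_rel Q0 Q1 pi) j ->
    connect (pol_rel Q0 Q1 pi) i j.

(* Average-reward optimality (Bellman) equation of the continuous-time
   single-bandit subsidy-nu problem (passive reward r0 i + nu). *)
Definition bellman (Q0 Q1 : 'M[R]_d) (r0 r1 : 'I_d -> R) (nu g : R)
  (h : 'I_d -> R) : Prop :=
  forall i, g = Num.max (r1 i + \sum_j Q1 i j * h j)
                        (r0 i + nu + \sum_j Q0 i j * h j).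

Definition passive (Q0 Q1 : 'M[R]_d) (r0 r1 : 'I_d -> R) (nu : R)
  (i : 'I_d) : Prop :=
  exists g h, bellman Q0 Q1 r0 r1 nu g h /\
    r1 i + \sum_j Q1 i j * h j <= r0 i + nu + \sum_j Q0 i j * h j.

Definition indexable (Q0 Q1 : 'M[R]_d) (r0 r1 : 'I_d -> R) : Prop :=
  (forall nu nu' i, nu <= nu' -> passive Q0 Q1 r0 r1 nu i ->
                    passive Q0 Q1 r0 r1 nu' i) /\
  (forall i, exists nu, passive Q0 Q1 r0 r1 nu i) /\
  (forall i, exists nu, ~ passive Q0 Q1 r0 r1 nu i).

Definition whittle_index (Q0 Q1 : 'M[R]_d) (r0 r1 : 'I_d -> R) (i : 'I_d) : R :=
  inf [set nu | passive Q0 Q1 r0 r1 nu i].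

Definition strictly_indexable_labeled (Q0 Q1 : 'M[R]_d) (r0 r1 : 'I_d -> R) : Prop :=
  indexable Q0 Q1 r0 r1 /\
  (forall i j : 'I_d, (i < j)%N ->
     whittle_index Q0 Q1 r0 r1 j < whittle_index Q0 Q1 r0 r1 i).

Definition in_simplex (m : 'I_d -> R) : Prop :=
  (forall i, 0 <= m i) /\ \sum_i m i = 1.

Definition tau (Q0 Q1 : 'M[R]_d) : R :=
  \big[Num.max/0]_(i < d) Num.max `|Q0 i i| `|Q1 i i|.

(* uniformized transition matrix P^a *)
Definition Pmat (Q0 Q1 : 'M[R]_d) (a : bool) (i j : 'I_d) : R :=
  if i == j then 1 - \sum_(k < d | k != i) Qa Q0 Q1 a i k / tau Q0 Q1
  else Qa Q0 Q1 a i j / tau Q0 Q1.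

Definition s_of (alpha : R) (m : 'I_d -> R) : option 'I_d :=
  [pick s : 'I_d | (\sum_(i < d | (i < s)%N) m i <= alpha) &&
                   (alpha < \sum_(i < d | (i <= s)%N) m i)].

Definition phi (Q0 Q1 : 'M[R]_d) (alpha : R) (m : 'I_d -> R) (j : 'I_d) : R :=
  match s_of alpha m with
  | Some s =>
      \sum_(i < d | (i < s)%N) m i * Pmat Q0 Q1 true i j
      + (alpha - \sum_(i < d | (i < s)%N) m i) * Pmat Q0 Q1 true s j
      + (\sum_(i < d | (i <= s)%N) m i - alpha) * Pmat Q0 Q1 false s j
      + \sum_(i < d | (s < i)%N) m i * Pmat Q0 Q1 false i j
  | None => 0
  end.

Definition ode_solution (Q0 Q1 : 'M[R]_d) (alpha : R) (x : R -> 'I_d -> R) : Prop :=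
  forall t : R, 0 <= t -> forall i : 'I_d,
    is_derive t 1 (fun s => x s i)
      (tau Q0 Q1 * (phi Q0 Q1 alpha (x t) i - x t i)).

Definition uniform_global_attractor (Q0 Q1 : 'M[R]_d) (alpha : R)
  (mstar : 'I_d -> R) : Prop :=
  forall eps : R, 0 < eps -> exists T : R,
    forall x : R -> 'I_d -> R, in_simplex (x 0) -> ode_solution Q0 Q1 alpha x ->
      forall t, T <= t -> forall i, `|x t i - mstar i| <= eps.

Definition singular (alpha : R) (m : 'I_d -> R) : Prop :=
  exists i : 'I_d, \sum_(j < d | (j <= i)%N) m j = alpha.

(* configuration = vector of counts of bandits in each state *)
Definition config (N : nat) := {ffun 'I_d -> 'I_N.+1}.

Definition valid_config N (x : config N) : bool := (\sum_i (x i : nat))%N == N.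

(* number of active bandits in state i when K = alpha N bandits with the
   highest indices (smallest labels) are activated *)
Definition nactive N (K : nat) (x : config N) (i : 'I_d) : nat :=
  minn (x i) (K - \sum_(k < d | (k < i)%N) (x k : nat)).

Definition jump N (x : config N) (i j : 'I_d) (y : config N) : bool :=
  [&& i != j, (y i : nat).+1 == x i, (y j : nat) == (x j).+1 &
      [forall k, ((k != i) && (k != j)) ==> ((y k : nat) == x k)]].

Definition rate (Q0 Q1 : 'M[R]_d) N K (x y : config N) : R :=
  \sum_i \sum_(j | jump x i j y)
     ((nactive K x i)%:R * Q1 i j + ((x i : nat) - nactive K x i)%:R * Q0 i j).

Definition stationary (Q0 Q1 : 'M[R]_d) N K (p : config N -> R) : Prop :=
  [/\ forall x, 0 <= p x,
      forall x, ~~ valid_config x -> p x = 0,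
      \sum_x p x = 1 &
      forall y, \sum_(x | x != y) p x * rate Q0 Q1 K x y
                = p y * \sum_(z | z != y) rate Q0 Q1 K y z].

Definition expected_M N (p : config N -> R) (i : 'I_d) : R :=
  \sum_x p x * ((x i : nat)%:R / N%:R).

End Defs.

(* Main.v *)
(* Uniformize the chain and run it in batches of [N %/ M] transitions. During a
   batch every coordinate of the empirical measure moves by at most [1 / M], so
   the drift is constant up to [O(1 / M)], and an exponential moment bound shows
   that, outside an event of probability exponentially small in [N], a batch is
   an Euler step of the ODE with error [O(1 / M ^ 2)]. For [M] large, every
   sequence of such inexact Euler steps is close to [mstar] after a fixed number
   of batches: otherwise a limit along an ultrafilter would be an ODE solution
   contradicting uniform attraction. By stationarity, the mass outside a
   neighbourhood of [mstar] is then exponentially small.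
   Near the nonsingular point [mstar] the drift is affine. As the stationary mean
   of the drift vanishes, the affine drift at the mean measure is exponentially
   small, and it bounds the distance to [mstar]: on the simplex it has no zero
   other than [mstar], since a zero near [mstar] is a constant ODE solution. *)

Require Import Defs.
From HB Require Import structures.
From mathcomp Require Import all_boot all_order all_algebra.
From mathcomp Require Import all_classical all_reals all_analysis.
From mathcomp Require Import ring lra zify.
Set Implicit Arguments. Unset Strict Implicit. Unset Printing Implicit Defensive.
Import Order.TTheory GRing.Theory Num.Theory.
Import numFieldNormedType.Exports.
Local Open Scope ring_scope.

(** * The drift of the mean-field dynamics *)

Section Drift.
Variables (R : realType) (d : nat) (Q0 Q1 : 'M[R]_d) (alpha : R).
Implicit Types (m : 'I_d -> R) (i j s : 'I_d).

Definition below m i : R := \sum_(k < d | (k < i)%N) m k.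

(** States are served in order of priority until the budget [alpha] is exhausted. The form with
    [min] and [max] needs no case distinction on [s_of] and makes Lipschitz bounds direct. *)
Definition active m i : R := Num.min (m i) (Num.max 0 (alpha - below m i)).

Definition drift m j : R :=
  \sum_i (active m i * Q1 i j + (m i - active m i) * Q0 i j).

(* The affine continuation of [active] and [drift] from the region where [s] is
   the partially activated state. *)
Definition aactive s m i : R :=
  if (i < s)%N then m i else if i == s then alpha - below m s else 0.

Definition adrift s m j : R :=
  \sum_i (aactive s m i * Q1 i j + (m i - aactive s m i) * Q0 i j).

Lemma sum_le_ord m s :
  \sum_(i < d | (i <= s)%N) m i = \sum_(i < d | (i < s)%N) m i + m s.
Proof.
rewrite (bigD1 s) //= addrC; congr (_ + _); apply: eq_bigl => i.
by rewrite andbC ltn_neqAle.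
Qed.

Lemma sum_split3 (F : 'I_d -> R) s :
  \sum_i F i = \sum_(i < d | (i < s)%N) F i + F s + \sum_(i < d | (s < i)%N) F i.
Proof.
rewrite (bigID (fun i : 'I_d => (i <= s)%N)) /= -sum_le_ord; congr (_ + _).
by apply: eq_bigl => i; rewrite ltnNge.
Qed.

Lemma le_below m i j : (forall k, 0 <= m k) -> (i < j)%N -> below m i + m i <= below m j.
Proof.
move=> m0 ij; rewrite -sum_le_ord /below [leRHS](bigID (fun k : 'I_d => (k <= i)%N)) /=.
rewrite [X in _ <= X + _](eq_bigl (fun k : 'I_d => (k <= i)%N)); last first.
  by move=> k; case: (leqP k i); rewrite ?andbF // => /leq_ltn_trans ->.
by rewrite lerDl sumr_ge0.
Qed.

(** States before [s] fit entirely in the budget, and states after [s] find it exhausted. Both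
    inequalities may be weak, since at a tie the neighbouring formulas agree. *)
Lemma active_aactive s m i : (forall k, 0 <= m k) ->
  below m s <= alpha <= below m s + m s -> active m i = aactive s m i.
Proof.
move=> m0 /andP[h1 h2]; rewrite /aactive /active.
have [/(le_below m0) le|lt|/val_inj ->] := ltngtP i s.
- by rewrite min_l // le_max; apply/orP; right; lra.
- have le := le_below m0 lt; rewrite -val_eqE /= gtn_eqF // max_l ?min_r ?m0 //; lra.
- by rewrite eqxx max_r ?min_r ?subr_ge0 // lerBlDl.
Qed.

Lemma drift_adrift s m j : (forall k, 0 <= m k) ->
  below m s <= alpha <= below m s + m s -> drift m j = adrift s m j.
Proof. by move=> m0 hs; apply: eq_bigr => i _; rewrite (active_aactive i m0 hs). Qed.

Lemma adriftE s m j : adrift s m j =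
  \sum_(i < d | (i < s)%N) m i * Q1 i j
  + (alpha - \sum_(i < d | (i < s)%N) m i) * Q1 s j
  + (\sum_(i < d | (i <= s)%N) m i - alpha) * Q0 s j
  + \sum_(i < d | (s < i)%N) m i * Q0 i j.
Proof.
rewrite /adrift (sum_split3 _ s) sum_le_ord -/(below m s) /aactive.
rewrite (eq_bigr (fun i => m i * Q1 i j)); last first.
  by move=> i ->; rewrite subrr mul0r addr0.
rewrite [X in _ + _ + X = _](eq_bigr (fun i => m i * Q0 i j)); last first.
  by move=> i si; rewrite ltnNge ltnW //= -val_eqE /= gtn_eqF // mul0r add0r subr0.
by rewrite ltnn eqxx -!addrA; congr (_ + _); rewrite !addrA; congr (_ + _); ring.
Qed.

Lemma s_of_some m : 0 < alpha < 1 -> in_simplex m ->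
  exists s, s_of alpha m = Some s /\ below m s <= alpha < below m s + m s.
Proof.
move=> /andP[a0 a1] [m0 m1].
suff [s hs] : exists s, (below m s <= alpha) && (alpha < \sum_(i < d | (i <= s)%N) m i).
  rewrite /s_of; case: pickP => [t ht|/(_ s)]; last by rewrite hs.
  by exists t; split=> //; rewrite /below -sum_le_ord.
case: (posnP d) => [d0|d0].
  have : (1 : R) = 0.
    by rewrite -m1 big1 // => i _; have := ltn_ord i; rewrite [X in (_ < X)%N]d0.
  by move/eqP; rewrite oner_eq0.
have hl : (d.-1 < d)%N by rewrite ltn_predL.
pose P (s : 'I_d) := alpha < \sum_(i < d | (i <= s)%N) m i.
(* The last state qualifies because the total mass 1 exceeds [alpha]. At the least qualifying state,
   failure of its predecessor gives the other inequality. *)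
have P0 : P (Ordinal hl).
  rewrite /P (eq_bigl xpredT) ?m1 // => i /=; have := ltn_ord i; lia.
case: (@arg_minnP _ (Ordinal hl) P (fun s => nat_of_ord s) P0) => s Ps smin.
exists s; rewrite -/(P s) Ps andbT.
case: (posnP s) => [s0|s0].
  by rewrite /below big1 ?ltW // => i; rewrite s0.
have hs : (s.-1 < d)%N by have := ltn_ord s; lia.
rewrite leNgt; apply/negP => h.
have := smin (Ordinal hs); rewrite /P /= => /(_ _).
have -> : alpha < \sum_(i < d | (i <= s.-1)%N) m i.
  by move: h; rewrite /below; congr (_ < _); apply: eq_bigl => i; lia.
by move=> /(_ isT); lia.
Qed.

Lemma tau_Pmat a i j : generator Q0 -> generator Q1 ->
  tau Q0 Q1 * Pmat Q0 Q1 a i j = Qa Q0 Q1 a i j + tau Q0 Q1 * (i == j)%:R.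
Proof.
rewrite mulr_natr.
move=> g0 g1; have [q0 q1] : generator (Qa Q0 Q1 a) by case: a.
have dg k : `|Qa Q0 Q1 a k k| <= tau Q0 Q1.
  apply: le_trans (le_bigmax 0 (fun k => Num.max `|Q0 k k| `|Q1 k k|) k).
  by rewrite /Qa; case: a {q0 q1}; rewrite le_max lexx ?orbT.
have sumE k : \sum_(l | l != k) Qa Q0 Q1 a k l = - Qa Q0 Q1 a k k.
  by have := q1 k; rewrite (bigD1 k) //= addrC => /eqP; rewrite addr_eq0 => /eqP.
(* If [tau] is 0, division by it returns 0. The diagonals then vanish, and zero row sums with
   nonnegative off-diagonal entries make all rates 0, so the identity survives. *)
rewrite /Pmat; have [t0|t0] := eqVneq (tau Q0 Q1) 0.
  rewrite t0 mul0r mul0rn addr0; apply/esym.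
  have qz k : Qa Q0 Q1 a k k = 0.
    by apply/eqP; rewrite -normr_eq0 eq_le normr_ge0 andbT -t0 dg.
  have [->//|ij] := eqVneq i j.
  have := sumE i; rewrite qz oppr0 => /eqP; rewrite psumr_eq0.
    by move=> /allP /(_ j (mem_index_enum _)); rewrite eq_sym ij => /eqP.
  by move=> k; rewrite eq_sym => /q0.
have [->|ij] := eqVneq i j; last by rewrite mulr0n addr0 mulrC divfK.
by rewrite -mulr_suml sumE mulNr opprK mulrDr mulr1 addrC mulrC divfK.
Qed.

(** The diagonal contributions of [tau_Pmat] add up to [tau * m j] and cancel. From here on [drift]
    replaces the right-hand side of the ODE. *)
Lemma drift_phi m j : generator Q0 -> generator Q1 -> 0 < alpha < 1 ->
  in_simplex m -> tau Q0 Q1 * (phi Q0 Q1 alpha m j - m j) = drift m j.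
Proof.
move=> g0 g1 ha sm; have [s [hs /andP[h1 h2]]] := s_of_some ha sm.
rewrite (@drift_adrift s m j) ?h1 ?(ltW h2) //; last by case: sm.
rewrite /phi hs adriftE !mulrBr !mulrDr.
pose T := tau Q0 Q1.
have E a (P : pred 'I_d) : T * (\sum_(i < d | P i) m i * Pmat Q0 Q1 a i j) =
   \sum_(i < d | P i) m i * Qa Q0 Q1 a i j + T * \sum_(i < d | P i) m i * (i == j)%:R.
  rewrite !mulr_sumr -big_split; apply: eq_bigr => i _ /=.
  by rewrite mulrCA tau_Pmat // -/T; ring.
have F a c : T * (c * Pmat Q0 Q1 a s j) = c * (Qa Q0 Q1 a s j + T * (s == j)%:R).
  by rewrite mulrCA tau_Pmat.
rewrite -/T !E !F sum_le_ord {E F} /=.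
have -> : m j = \sum_i m i * (i == j)%:R.
  by rewrite (bigD1 j) //= eqxx mulr1 big1 ?addr0 // => i /negbTE ->; rewrite mulr0.
rewrite (sum_split3 _ s); ring.
Qed.

End Drift.

Lemma dist_min (R : realDomainType) (a b a' b' e : R) :
  `|a - a'| <= e -> `|b - b'| <= e -> `|Num.min a b - Num.min a' b'| <= e.
Proof. rewrite !ler_distl; case: (leP a b); case: (leP a' b'); lra. Qed.

Lemma dist_max (R : realDomainType) (a b a' b' e : R) :
  `|a - a'| <= e -> `|b - b'| <= e -> `|Num.max a b - Num.max a' b'| <= e.
Proof. rewrite !ler_distl; case: (leP a b); case: (leP a' b'); lra. Qed.

Lemma simplex_le1 (R : realType) d (m : 'I_d -> R) i : in_simplex m -> m i <= 1.
Proof. by case=> m0 <-; rewrite (bigD1 i) //= lerDl sumr_ge0. Qed.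

(** * Compactness of the simplex along an ultrafilter *)

Section UltraLimit.
Local Open Scope classical_set_scope.

(** An ultrafilter decides every preimage, so a cluster point, which compactness of the unit
    interval supplies, is already a limit. *)
Lemma ultra_limit (R : realType) (U : set_system nat) (u : nat -> R) :
  UltraFilter U -> (forall n, 0 <= u n <= 1) -> exists l : R, u n @[n --> U] --> l.
Proof.
move=> UU hu.
have [|l [_ lc]] := @segment_compact R 0 1 (fmap u U) _.
  by apply: (@filterS _ U _ setT _ _ filterT) => n _; rewrite /fmap /= in_itv /= hu.
exists l => A Al; case: (in_ultra_setVsetC (u @^-1` A) UU) => // UnA.
by have [z [/= nA zA]] := lc (~` A) A UnA Al.
Qed.

(* Compactness of the simplex simultaneously at all parameters [t], phrased
   through finitely many evaluations along one ultrafilter. *)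
Lemma simplex_limit (R : realType) d (T : Type) (y : nat -> T -> 'I_d -> R) :
  (forall n t, in_simplex (y n t)) ->
  exists x : T -> 'I_d -> R, (forall t, in_simplex (x t)) /\
    forall s t n0 e, 0 < e -> exists n, [/\ (n0 <= n)%N,
      forall i, `|y n s i - x s i| <= e & forall i, `|y n t i - x t i| <= e].
Proof.
move=> ys; have [U [UU sU]] := ultraFilterLemma (@eventually_filter).
have lim t i : exists l : R, y n t i @[n --> U] --> l.
  apply: (@ultra_limit R U (fun n => y n t i)) => n.
  by rewrite simplex_le1 ?andbT //; case: (ys n t).
have [x xP] : {x : T -> 'I_d -> R | forall t i, y n t i @[n --> U] --> x t i}.
  by exists (fun t i => projT1 (cid (lim t i))) => t i; case: (cid (lim t i)).
exists x; split=> [t|s t n0 e e0].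
  split=> [i|].
    by apply: cvgr_to_ge (xP t i) _; apply: nearW => n; case: (ys n t).
  have : (\sum_i y n t i) @[n --> U] --> \sum_i x t i.
    by apply: cvg_big => [|i _]; [exact: add_continuous|exact: xP].
  have -> : (fun n => \sum_i y n t i) = (fun=> 1).
    by apply/funext => n; case: (ys n t).
  move=> h; have := cvg_unique _ h (cvg_cst _); exact.
have near t' : \forall n \near U, forall i, `|y n t' i - x t' i| <= e.
  apply: filter_forall => i; near=> n; rewrite distrC; near: n.
  by move: (xP t' i) => /cvgrPdist_le; exact.
have n0U : \forall n \near U, (n0 <= n)%N by apply: sU; exists n0.
have [n [h1 [h2 h3]]] := @filter_ex _ U _ _
  (@filterI _ U _ _ _ n0U (@filterI _ U _ _ _ (near s) (near t))).
by exists n.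
Unshelve. all: by end_near. Qed.

End UltraLimit.

(** * Boundedness and Lipschitz continuity of the drift *)

Section Regularity.
Variables (R : realType) (d : nat) (Q0 Q1 : 'M[R]_d) (alpha : R).
Implicit Types (m : 'I_d -> R) (i j s : 'I_d).
Local Notation drift := (drift Q0 Q1 alpha).
Local Notation active := (active alpha).

(** This becomes the uniformization rate per bandit. The summand 1 keeps it positive when all rates
    vanish. *)
Definition Lam : R := \sum_i \sum_j (`|Q0 i j| + `|Q1 i j|) + 1.
Definition Lip : R := d.+2%:R * Lam.

Lemma Lam_ge1 : 1 <= Lam.
Proof. by rewrite lerDr sumr_ge0 // => i _; rewrite sumr_ge0 // => j _; rewrite addr_ge0. Qed.

Lemma Lam_gt0 : 0 < Lam. Proof. exact: lt_le_trans Lam_ge1. Qed.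

Lemma Lip_ge0 : 0 <= Lip. Proof. by rewrite mulr_ge0 // ltW // Lam_gt0. Qed.

Lemma col_sum_le (c : R) j (F : 'I_d -> R) : 0 <= c ->
  (forall i, `|F i| <= c * (`|Q0 i j| + `|Q1 i j|)) ->
  `|\sum_i F i| <= c * Lam.
Proof.
move=> c0 h; apply: le_trans (ler_norm_sum _ _ _) _.
apply: le_trans (ler_sum _ (fun i _ => h i)) _.
rewrite -mulr_sumr ler_wpM2l // /Lam ler_wpDr //.
by apply: ler_sum => i _; rewrite (bigD1 j) //= lerDl sumr_ge0 // => k _; rewrite addr_ge0.
Qed.

Lemma active_ge0 m i : 0 <= m i -> 0 <= active m i.
Proof. by move=> h; rewrite le_min h le_max lexx. Qed.

Lemma active_le m i : active m i <= m i.
Proof. by rewrite ge_min lexx. Qed.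

Lemma drift_bound m j : in_simplex m -> `|drift m j| <= Lam.
Proof.
move=> sm; rewrite -[leRHS]mul1r; apply: (@col_sum_le _ j) => // i.
have [m0 _] := sm; have m1 := simplex_le1 i sm.
have a0 := active_ge0 (m0 i); have a1 := active_le m i.
apply: le_trans (ler_normD _ _) _; rewrite !normrM mul1r addrC.
by apply: lerD; rewrite ler_piMl ?normr_ge0 // ger0_norm //; lra.
Qed.

Lemma below_lip m m' e s : 0 <= e -> (forall i, `|m i - m' i| <= e) ->
  `|below m s - below m' s| <= d%:R * e.
Proof.
move=> e0 h; rewrite /below -sumrB (le_trans (ler_norm_sum _ _ _)) //.
apply: le_trans (ler_sum _ (fun k _ => h k)) _.
rewrite sumr_const -[e *+ _]mulr_natl ler_wpM2r // ler_nat.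
by rewrite -[leqRHS]card_ord max_card.
Qed.

(** As [min] and [max] are nonexpansive, the active mass of a state moves by at most [d.+1 * e]. The
    passive mass then moves by at most [d.+2 * e], whence the factor in [Lip]. *)
Lemma drift_lip m m' e j : (forall k, `|m k - m' k| <= e) ->
  `|drift m j - drift m' j| <= Lip * e.
Proof.
move=> h; have e0 : 0 <= e by exact: le_trans (h j).
rewrite /drift -sumrB /Lip mulrAC.
apply: (@col_sum_le _ j) => [|i]; first by rewrite mulr_ge0.
have hb := below_lip i e0 h.
have e1 : e <= d.+1%:R * e by rewrite ler_peMl // ler1n.
have e2 : d%:R * e <= d.+1%:R * e by rewrite ler_wpM2r // ler_nat.
have ha : `|active m i - active m' i| <= d.+1%:R * e.
  apply: dist_min; first exact: le_trans (h i) _.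
  apply: dist_max; first by rewrite subrr normr0 mulr_ge0.
  by apply: le_trans e2; rewrite distrC (_ : _ - _ = below m i - below m' i) //; ring.
have hc : `|(m i - active m i) - (m' i - active m' i)| <= d.+2%:R * e.
  rewrite -natr1 mulrDl mul1r.
  rewrite (_ : _ - _ = (active m' i - active m i) + (m i - m' i)); last by ring.
  by rewrite (le_trans (ler_normD _ _)) // lerD // distrC.
rewrite (_ : _ - _ = ((m i - active m i) - (m' i - active m' i)) * Q0 i j
  + (active m i - active m' i) * Q1 i j); last by ring.
rewrite (le_trans (ler_normD _ _)) // !normrM mulrDr lerD // ler_wpM2r //.
by apply: le_trans ha _; rewrite ler_wpM2r // ler_nat.
Qed.

End Regularity.

(** * Inexact Euler schemes and the ODE *)

(** The restriction [e <= 1] lets callers absorb terms in [e ^ 2] into the linear error. *)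
Lemma le_add_smallP (R : realFieldType) (a b c : R) :
  (forall e, 0 < e <= 1 -> a <= b + c * e) -> a <= b.
Proof.
move=> h; rewrite leNgt; apply/negP => ba.
have c0 : 0 < `|c| + 1 by rewrite ltr_wpDl.
pose e := Num.min 1 ((a - b) / (2 * (`|c| + 1))).
have e0 : 0 < e by rewrite lt_min ltr01 divr_gt0 ?subr_gt0 // mulr_gt0.
have /h : 0 < e <= 1 by rewrite e0 ge_min lexx.
have : e * (2 * (`|c| + 1)) <= a - b.
  by rewrite -ler_pdivlMr ?mulr_gt0 // ge_min lexx orbT.
have : c * e <= `|c| * e by rewrite ler_wpM2r ?(ltW e0) // ler_norm.
have : 0 <= `|c| * e by rewrite mulr_ge0 ?(ltW e0).
lra.
Qed.

Lemma is_derive_quad (R : realType) (f : R -> R) (t v B r : R) : 0 < r ->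
  (forall h, `|h| <= r -> `|f (t + h) - f t - h * v| <= B * h ^+ 2) ->
  is_derive t 1 f v.
Proof.
move=> r0 H.
have B0 : 0 <= B.
  have := H r; rewrite (ger0_norm (ltW r0)) => /(_ (lexx _)).
  by move/(le_trans (normr_ge0 _)); rewrite pmulr_lge0 // exprn_gt0.
suff C : (h^-1 *: ((f \o shift t) (h *: 1) - f t) @[h --> 0^'] --> v)%classic.
  by apply: DeriveDef; [apply/cvg_ex; exists v | exact: (cvg_lim _ C)].
apply/cvgrPdist_le => e e0; near=> h.
have h0 : h != 0 by near: h; exact: nbhs_dnbhs_neq.
have hr : `|h| <= Num.min r (e / (B + 1)).
  near: h; apply: dnbhs0_le; rewrite lt_min r0 divr_gt0 // ltr_wpDl //.
move: hr; rewrite le_min => /andP[hr he].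
rewrite /= [h *: 1]mulr1 (addrC h t) distrC.
have -> : h^-1 *: (f (t + h) - f t) - v = h^-1 * (f (t + h) - f t - h * v).
  by rewrite [RHS]mulrBr mulrA mulVf // mul1r.
rewrite normrM normfV ler_pdivrMl ?normr_gt0 //.
apply: le_trans (H h hr) _; rewrite -(real_normK (num_real h)) expr2.
move: he; rewrite ler_pdivlMr ?ltr_wpDl // => he.
by have := normr_ge0 h; nra.
Unshelve. all: by end_near. Qed.

Section PseudoTraj.
Variables (R : realType) (d : nat) (Q0 Q1 : 'M[R]_d) (alpha : R).
Implicit Types (m : 'I_d -> R) (i j s : 'I_d).
Local Notation drift := (drift Q0 Q1 alpha).
Local Notation Lam := (Lam Q0 Q1).
Local Notation Lip := (Lip Q0 Q1).

(** An approximate Euler step of duration [1 / (M * Lam)], which is the mean time of [N / M]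
    transitions at rate [Lam * N]. *)
Definition estep (C : R) (M : nat) m m' : Prop :=
  forall k, `|m' k - m k - drift m k / (M%:R * Lam)| <= C / M%:R ^+ 2.

Definition pseudo_traj (C : R) (M : nat) (y : nat -> 'I_d -> R) : Prop :=
  (forall k, in_simplex (y k)) /\ (forall k, estep C M (y k) (y k.+1)).

(** The drift, in units of [Lam], varies by at most [incr_const C / M] along one step. *)
Definition incr_const (C : R) : R := d.+2%:R * (1 + C).

Section Fixed.
Variables (C : R) (M : nat) (y : nat -> 'I_d -> R).
Hypotheses (C0 : 0 <= C) (M0 : (0 < M)%N) (py : pseudo_traj C M y).
Let M1 : 1 <= M%:R :> R. Proof. by rewrite ler1n. Qed.
Let M0r : 0 < M%:R :> R. Proof. by rewrite ltr0n. Qed.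

Lemma pseudo_traj_disp k q i : `|y (k + q) i - y k i| <= q%:R * (1 + C) / M%:R.
Proof.
elim: q => [|q IH]; first by rewrite addn0 subrr normr0 !mul0r.
have [_ /(_ (k + q)%N i)] := py.
have := drift_bound Q0 Q1 alpha i (py.1 (k + q)%N).
set D := drift _ _ => hD hs.
have hD' : `|D / (M%:R * Lam)| <= 1 / M%:R.
  rewrite normrM normfV [`|_ * Lam|]gtr0_norm ?mulr_gt0 ?Lam_gt0 //.
  rewrite ler_pdivrMr ?mulr_gt0 ?Lam_gt0 //.
  have -> : 1 / M%:R * (M%:R * Lam) = Lam by field; rewrite gt_eqF.
  exact: hD.
have hC : C / M%:R ^+ 2 <= C / M%:R.
  by rewrite ler_wpM2l // lef_pV2 ?posrE ?exprn_gt0 // ler_eXnr.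
rewrite addnS -[q.+1%:R]natr1.
rewrite (_ : y (k + q).+1 i - y k i = (y (k + q).+1 i - y (k + q)%N i - D / (M%:R * Lam))
   + D / (M%:R * Lam) + (y (k + q)%N i - y k i)); last by ring.
apply: le_trans (ler_normD _ _) _.
have := ler_normD (y (k + q).+1 i - y (k + q)%N i - D / (M%:R * Lam)) (D / (M%:R * Lam)).
rewrite !mulrDl mul1r; move: IH; rewrite !mulrDl; lra.
Qed.

(** The drift is frozen at its initial value. After [q] steps it is off by at most
    [Lip * q * (1 + C) / M], and these errors add up to the term in [q ^ 2]. For [q] of order [M]
    this term is quadratic in the elapsed time, while the other one is [O(1 / M)]. *)
Lemma pseudo_traj_euler k q i :
  `|y (k + q) i - y k i - q%:R * drift (y k) i / (M%:R * Lam)|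
    <= (q%:R * C + incr_const C * q%:R ^+ 2) / M%:R ^+ 2.
Proof.
have L0 := Lam_gt0 Q0 Q1.
elim: q => [|q IH].
  by rewrite addn0 subrr !mul0r subrr normr0 expr0n /= mulr0 addr0 mul0r.
have [_ /(_ (k + q)%N i) hs] := py.
have hd := drift_lip Q0 Q1 alpha i (pseudo_traj_disp k q).
set D := drift (y k) i in hd IH *; set D' := drift _ _ in hs hd.
have hD : `|(D' - D) / (M%:R * Lam)| <= incr_const C * q%:R / M%:R ^+ 2.
  rewrite normrM [X in _ * X]ger0_norm ?invr_ge0 ?mulr_ge0 ?ler0n ?(ltW L0) //.
  rewrite ler_pdivrMr ?mulr_gt0 //; apply: le_trans hd _.
  rewrite /Lip /incr_const le_eqVlt; apply/orP; left; apply/eqP.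
  by field; rewrite gt_eqF.
rewrite addnS -[q.+1%:R]natr1.
rewrite (_ : _ - _ = (y (k + q).+1 i - y (k + q)%N i - D' / (M%:R * Lam))
   + (D' - D) / (M%:R * Lam)
   + (y (k + q)%N i - y k i - q%:R * D / (M%:R * Lam))); last by ring.
apply: le_trans (ler_normD _ _) _; apply: le_trans (lerD (ler_normD _ _) (lexx _)) _.
apply: le_trans (lerD (lerD hs hD) IH) _.
rewrite -!mulrDl ler_pM2r ?invr_gt0 ?exprn_gt0 //.
have : 0 <= incr_const C by rewrite mulr_ge0 // addr_ge0.
have : 0 <= q%:R :> R by [].
set I := incr_const C; set n := q%:R; nra.
Qed.

End Fixed.

Lemma drift_sum0 m : generator Q0 -> generator Q1 -> \sum_j drift m j = 0.
Proof.
move=> [_ g0] [_ g1]; rewrite exchange_big big1 // => i _ /=.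
by rewrite big_split /= -!mulr_sumr g0 g1 !mulr0 addr0.
Qed.

(** Mass leaves a state at rate at most [Lam] per unit of mass, so a step with [h * Lam <= 1] cannot
    make a coordinate negative. *)
Lemma euler_simplex m (h : R) : generator Q0 -> generator Q1 ->
  0 <= h * Lam <= 1 -> 0 <= h -> in_simplex m -> in_simplex (fun j => m j + h * drift m j).
Proof.
move=> g0 g1 /andP[_ hL] h0 [m0 m1]; split=> [j|]; last first.
  by rewrite big_split /= m1 -mulr_sumr drift_sum0 // mulr0 addr0.
have [[g0' _] [g1' _]] := (g0, g1).
have : - (Lam * m j) <= drift m j.
  rewrite /drift (bigD1 j) //= addrC ler_wpDl //.
    apply: sumr_ge0 => i ij; rewrite addr_ge0 // mulr_ge0 ?g0' ?g1' ?active_ge0 //.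
    by rewrite subr_ge0 active_le.
  have a0 := active_ge0 alpha (m0 j); have a1 := active_le alpha m j.
  have : `|Q0 j j| + `|Q1 j j| <= Lam.
    apply: (@le_trans _ _ (\sum_l (`|Q0 j l| + `|Q1 j l|))).
      by rewrite (bigD1 j) //= lerDl sumr_ge0 // => l _; rewrite addr_ge0.
    rewrite ler_wpDr // [leRHS](bigD1 j) //= lerDl sumr_ge0 // => k _.
    by rewrite sumr_ge0 // => l _; rewrite addr_ge0.
  have := normr_ge0 (Q0 j j); have := normr_ge0 (Q1 j j).
  have := ler_norm (- Q0 j j); have := ler_norm (- Q1 j j); rewrite !normrN.
  move: a0 a1; set a := active _ _ _; nra.
have := m0 j; nra.
Qed.

(** Derivatives are two-sided, but the estimate is only forward in time. A backward increment is a
    forward one from [t + h], with the drift carried back to [t] by Lipschitz continuity. At time 0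
    the affine extension supplies the left derivative. *)
Lemma ode_solution_quad (x : R -> 'I_d -> R) (B : R) :
  generator Q0 -> generator Q1 -> 0 < alpha < 1 ->
  (forall t, 0 <= t -> in_simplex (x t)) ->
  (forall t h i, 0 <= t -> 0 <= h ->
    `|x (t + h) i - x t i - h * drift (x t) i| <= B * h ^+ 2) ->
  (forall t i, t < 0 -> x t i = x 0 i + t * drift (x 0) i) ->
  ode_solution Q0 Q1 alpha x.
Proof.
move=> g0 g1 ha xs xe xn t t0 i; rewrite drift_phi //; last exact: xs.
have B0 : 0 <= B.
  by have := xe 0 1 i (lexx _) ler01; rewrite expr1n mulr1 => /(le_trans (normr_ge0 _)).
have L0 := Lip_ge0 Q0 Q1; have La := Lam_gt0 Q0 Q1.
(* For positive [t], [r <= t] keeps [t + h] nonnegative; [r <= 1] lets [h ^ 2] be bounded by [- h]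
   for negative [h]. *)
pose r := if t == 0 then 1 else Num.min 1 t.
have r1 : r <= 1 by rewrite /r; case: ifP => // _; rewrite ge_min lexx.
have r0 : 0 < r.
  by rewrite /r; case: ifPn => // tn; rewrite lt_min ltr01 lt_neqAle eq_sym tn.
apply: (@is_derive_quad _ _ _ _ (B + Lip * (Lam + B)) r) => // h hr.
have [h0|h0] := leP 0 h.
  apply: le_trans (xe t h i t0 h0) _; rewrite ler_wpM2r ?sqr_ge0 // lerDl.
  by rewrite mulr_ge0 // addr_ge0 // ltW.
have [te|tn] := eqVneq t 0.
  rewrite te add0r xn // [X in `|X|](_ : _ = 0) ?normr0; last by ring.
  rewrite mulr_ge0 ?sqr_ge0 //.
  by rewrite addr_ge0 // mulr_ge0 // addr_ge0 // ltW.
have ht : 0 <= t + h.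
  move: hr; rewrite /r (negbTE tn) le_min ltr0_norm // => /andP[_]; lra.
have hh : 0 <= - h by rewrite oppr_ge0 ltW.
have E k := xe (t + h) (- h) k ht hh.
rewrite addrK sqrrN in E.
have h1 : - h <= 1 by rewrite (le_trans _ r1) // -ltr0_norm.
have D k : `|x (t + h) k - x t k| <= - h * (Lam + B).
  have := E k; have := drift_bound Q0 Q1 alpha k (xs _ ht).
  set a := x t k; set b := x _ k; set c := drift _ _; rewrite !ler_norml.
  have : B * h ^+ 2 <= - h * B by rewrite mulrC ler_wpM2r // expr2; nra.
  move: hh La; nra.
have {D} D := drift_lip Q0 Q1 alpha i D.
have {E} E := E i.
rewrite (_ : _ - _ = - (x t i - x (t + h) i - - h * drift (x (t + h)) i)
   + h * (drift (x (t + h)) i - drift (x t) i)); last by ring.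
apply: le_trans (ler_normD _ _) _; rewrite normrN mulrDl lerD //.
rewrite normrM ltr0_norm // (le_trans (ler_wpM2l hh D)) //.
by rewrite le_eqVlt; apply/orP; left; apply/eqP; ring.
Qed.

End PseudoTraj.

Lemma inv_succ_le (R : archiRealFieldType) (e : R) n :
  0 < e -> (Num.truncn e^-1 <= n)%N -> n.+1%:R^-1 <= e.
Proof.
move=> e0 hn; rewrite -[e]invrK lef_pV2 ?posrE ?invr_gt0 //.
have e1 : 0 <= e^-1 by rewrite invr_ge0 ltW.
by have /andP[_ /ltW/le_trans] := truncn_itv e1; apply; rewrite ler_nat ltnS.
Qed.

(** * Limits of Euler schemes and consequences of uniform attraction *)

Section Attract.
Variables (R : realType) (d : nat) (Q0 Q1 : 'M[R]_d) (alpha : R).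
Hypotheses (g0 : generator Q0) (g1 : generator Q1) (ha : 0 < alpha < 1).
Implicit Types (m : 'I_d -> R) (i j s : 'I_d).
Local Notation drift := (drift Q0 Q1 alpha).
Local Notation Lam := (Lam Q0 Q1).
Local Notation Lip := (Lip Q0 Q1).
Local Notation pseudo_traj := (pseudo_traj Q0 Q1 alpha).

(** Scheme number [n] has [M = n.+1]; this counts its complete steps up to time [t]. *)
Definition step_index (n : nat) (t : R) : nat := Num.truncn (t * Lam * n.+1%:R).

Lemma step_index_bounds n t : 0 <= t ->
  (step_index n t)%:R <= t * Lam * n.+1%:R < (step_index n t)%:R + 1.
Proof.
move=> t0; rewrite natr1; apply: truncn_itv.
by rewrite !mulr_ge0 // ltW // Lam_gt0.
Qed.

(** The limit is taken at all times along one ultrafilter. Comparing times [t] and [t + h] at a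
    common large [n], [pseudo_traj_euler] passes to the limit as a quadratic increment estimate,
    which identifies the derivative. *)
Lemma pseudo_traj_limit (C : R) (y : nat -> nat -> 'I_d -> R) : 0 <= C ->
  (forall n, pseudo_traj C n.+1 (y n)) ->
  exists x : R -> 'I_d -> R, [/\ in_simplex (x 0), ode_solution Q0 Q1 alpha x &
    forall t e, 0 <= t -> 0 < e ->
      exists n, forall i, `|y n (step_index n t) i - x t i| <= e].
Proof.
move=> C0 py.
have [x0 [xs xl]] := @simplex_limit R d R (fun n t => y n (step_index n t))
  (fun n t => (py n).1 _).
pose x t i := if t < 0 then x0 0 i + t * drift (x0 0) i else x0 t i.
have xE t : 0 <= t -> x t = x0 t by move=> t0; apply/funext => i; rewrite /x ltNge t0.
exists x; split.
- by rewrite xE.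
- pose B := incr_const d C * Lam ^+ 2.
  apply: (@ode_solution_quad _ _ _ _ _ _ B) => //.
  + by move=> t t0; rewrite xE.
  + move=> t h i t0 h0; rewrite !xE ?addr_ge0 //.
    apply: (@le_add_smallP _ _ _ ((h + 1) * Lam * C + B * (2 * h + 1) + 2 + Lam + h * Lip)).
    move=> e /andP[e0 e1].
    have [n [hn hs ht]] := xl (t + h) t (Num.truncn e^-1) e e0.
    have M0 : (0 : R) < n.+1%:R by [].
    have Me := inv_succ_le e0 hn.
    have /andP[k1 k2] := step_index_bounds n t0.
    have /andP[l1 l2] := step_index_bounds n (addr_ge0 t0 h0).
    have L1 := Lam_ge1 Q0 Q1; have L0 := Lam_gt0 Q0 Q1.
    have kl : (step_index n t <= step_index n (t + h))%N.
      rewrite -ltnS -(ltr_nat R) -natr1.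
      apply: le_lt_trans k1 (le_lt_trans _ l2).
      by rewrite ler_wpM2r // ler_wpM2r ?lerDl // ltW.
    move: hs ht l1 l2; set k := step_index n t in k1 k2 kl *.
    have [q ->] : exists q, step_index n (t + h) = (k + q)%N.
      by exists (step_index n (t + h) - k)%N; rewrite subnKC.
    have := pseudo_traj_euler C0 (ltn0Sn n) (py n) k q i.
    have := drift_bound Q0 Q1 alpha i ((py n).1 k).
    set Y := y n (k + q)%N; set Z := y n k => hb he hs ht l1 l2.
    have hl := drift_lip Q0 Q1 alpha i ht; move: {hs ht} (hs i) (ht i) => hs ht.
    rewrite natrD in l1 l2.
    set M := n.+1%:R in he M0 Me k1 k2 l1 l2.
    set w := x0 t i in ht *; set z := x0 (t + h) i in hs *.
    set D := drift Z i in hb hl he; set E := drift (x0 t) i in hl *.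
    have ML0 : 0 < M * Lam by rewrite mulr_gt0.
    (* The time really spent in the [q] steps; rounding separates it from [h] by at most one
       step. *)
    pose a := q%:R / (M * Lam).
    have qa : q%:R = a * (M * Lam) by rewrite divfK // gt_eqF.
    have ah : `|a - h| <= e.
      apply: le_trans Me; rewrite -[M^-1]mul1r ler_pdivlMr //.
      have : `|(a - h) * (M * Lam)| <= 1.
        by rewrite mulrBl -qa ler_norml; lra.
      rewrite normrM (gtr0_norm ML0) mulrA; apply: le_trans.
      by rewrite ler_peMr // mulr_ge0 // ltW.
    have a0 : 0 <= a by rewrite divr_ge0 // ltW.
    have {}he : `|Y i - Z i - a * D| <= a * Lam * C / M + B * a ^+ 2.
      apply: le_trans (_ : _ <= (q%:R * C + incr_const d C * q%:R ^+ 2) / M ^+ 2) _.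
        by move: he; rewrite /a (mulrAC _ D).
      rewrite /B qa le_eqVlt; apply/orP; left; apply/eqP; field; exact: lt0r_neq0.
    clearbody a; have ale : a <= h + e by move: ah; rewrite ler_norml; lra.
    have t1 : a * Lam * C / M <= (h + 1) * Lam * C * e.
      apply: ler_pM Me; [by rewrite !mulr_ge0 // ltW | by rewrite invr_ge0 ltW |].
      by rewrite ler_wpM2r // ler_wpM2r ?(ltW L0) //; lra.
    have B0 : 0 <= B by rewrite /B /incr_const mulr_ge0 ?sqr_ge0 // mulr_ge0 // addr_ge0.
    have t2 : B * a ^+ 2 <= B * (h ^+ 2 + (2 * h + 1) * e).
      by rewrite ler_wpM2l // !expr2; nra.
    have t3 : `|(a - h) * D| <= Lam * e.
      by rewrite normrM mulrC ler_pM.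
    have t4 : `|h * (D - E)| <= h * (Lip * e).
      by rewrite normrM ger0_norm // ler_wpM2l.
    (* In order: the Euler error, the approximation errors at [t + h] and [t], the time rounding,
       and the change of drift from [Z] to the limit point. *)
    rewrite (_ : z - w - h * E = (Y i - Z i - a * D) - (Y i - z) + (Z i - w)
      + (a - h) * D + h * (D - E)); last by ring.
    rewrite (_ : B * h ^+ 2 + _ = (h + 1) * Lam * C * e + B * (h ^+ 2 + (2 * h + 1) * e)
      + e + e + Lam * e + h * (Lip * e)); last by ring.
    do 3 (apply: le_trans (ler_normD _ _) _; apply: lerD => //).
    apply: le_trans (ler_normB _ _) _; apply: lerD => //.
    exact: le_trans he (lerD t1 t2).
  + by move=> t i t0; rewrite (xE 0) // /x t0.
- move=> t e t0 e0; have [n [_ h _]] := xl t t 0%N e e0.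
  by exists n; rewrite xE.
Qed.

(** If no [M] worked at the time when ODE solutions are within [eps / 2], counterexamples for every
    [M] would have a limit solving the ODE. One of them would be within [eps / 2] of that solution
    at this time, hence within [eps] of [mstar]. *)
Lemma attract (C : R) (mstar : 'I_d -> R) (eps : R) : 0 <= C -> 0 < eps ->
  uniform_global_attractor Q0 Q1 alpha mstar ->
  exists M K : nat, (0 < M)%N /\
    forall y, pseudo_traj C M y -> forall i, `|y K i - mstar i| <= eps.
Proof.
move=> C0 eps0 att; have [T hT] := att (eps / 2) (divr_gt0 eps0 (ltr0Sn _ _)).
pose t := Num.max 0 T.
have t0 : 0 <= t by rewrite le_max lexx.
suff [n hn] : exists n, forall y, pseudo_traj C n.+1 y ->
    forall i, `|y (step_index n t) i - mstar i| <= eps.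
  by exists n.+1, (step_index n t).
apply: contrapT => /forallNP H.
have {}H n : exists y, pseudo_traj C n.+1 y /\
    ~ forall i, `|y (step_index n t) i - mstar i| <= eps.
  by have /existsNP [y /not_implyP [h1 h2]] := H n; exists y.
pose y n := projT1 (cid (H n)).
have [py ny] : (forall n, pseudo_traj C n.+1 (y n)) /\
    forall n, ~ forall i, `|y n (step_index n t) i - mstar i| <= eps.
  by split=> n; rewrite /y; case: (cid (H n)) => z [].
have [x [x0 sx lx]] := pseudo_traj_limit C0 py.
have [n hn] := lx t (eps / 2) t0 (divr_gt0 eps0 (ltr0Sn _ _)).
apply: (ny n) => i.
have := hT x x0 sx t; rewrite le_max lexx orbT => /(_ isT i).
move: (hn i); rewrite !ler_norml; lra.
Qed.

(** A zero of the drift is a constant solution, which the attractor forces to be [mstar]. *)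
Lemma zero_drift_unique (mstar m : 'I_d -> R) :
  uniform_global_attractor Q0 Q1 alpha mstar ->
  in_simplex m -> (forall j, drift m j = 0) -> m = mstar.
Proof.
move=> att sm hd; apply/funext => i; apply/eqP; rewrite -subr_eq0 -normr_le0.
apply: (@le_add_smallP _ _ _ 1) => e /andP[e0 _]; rewrite add0r mul1r.
have [T hT] := att e e0; apply: (hT (fun=> m)) (lexx T) i => // t _ i.
by rewrite drift_phi // hd; exact: is_derive_cst.
Qed.

(** By compactness, points away from [mstar] with drift tending to 0 would accumulate at a second
    zero of the drift. *)
Lemma drift_away (mstar : 'I_d -> R) (r : R) : 0 < r ->
  uniform_global_attractor Q0 Q1 alpha mstar ->
  exists gam : R, 0 < gam /\ forall m, in_simplex m ->
    (exists i, r <= `|m i - mstar i|) -> exists j, gam <= `|drift m j|.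
Proof.
move=> r0 att; apply: contrapT => /forallNP H.
have {}H (n : nat) : exists m, [/\ in_simplex m, exists i, r <= `|m i - mstar i| &
     forall j, `|drift m j| <= n.+1%:R^-1].
  have /not_andP[/(_ _)|] := H n.+1%:R^-1; first by case; rewrite invr_gt0.
  move=> /existsNP [m /not_implyP [h1 /not_implyP [h2 h3]]]; exists m; split=> // j.
  by rewrite leNgt; apply/negP => h; apply: h3; exists j; exact: ltW.
pose m n := projT1 (cid (H n)).
have mP n : [/\ in_simplex (m n), exists i, r <= `|m n i - mstar i| &
     forall j, `|drift (m n) j| <= n.+1%:R^-1] by rewrite /m; case: (cid (H n)).
have [x [xs xl]] := @simplex_limit R d unit (fun n _ => m n)
  (fun n _ => let: And3 h _ _ := mP n in h).
have xm : x tt = mstar.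
  apply: zero_drift_unique => // j.
  apply/eqP; rewrite -normr_le0; apply: (@le_add_smallP _ _ _ (Lip + 1)) => e /andP[e0 _].
  have [n [hn hx _]] := xl tt tt (Num.truncn e^-1) e e0.
  have [_ _ /(_ j) hm] := mP n.
  have := drift_lip Q0 Q1 alpha j hx.
  have := inv_succ_le e0 hn.
  move: hm; rewrite ler_distl !ler_norml; set u := _^-1; lra.
have [n [_ hx _]] := xl tt tt 0%N (r / 2) (divr_gt0 r0 (ltr0Sn _ _)).
have [_ [i hi] _] := mP n; have := hx i; rewrite xm; lra.
Qed.

End Attract.

(** * The generator of the configuration chain *)

Section Jumps.
Variables (R : realType) (d : nat) (Q0 Q1 : 'M[R]_d) (N K : nat).
Implicit Types (x y z : config d N) (i j k : 'I_d) (h : config d N -> R).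

Definition empirical x i : R := (x i : nat)%:R / N%:R.

Definition jrate x i j : R :=
  (nactive K x i)%:R * Q1 i j + ((x i : nat) - nactive K x i)%:R * Q0 i j.

Definition gen h x : R := \sum_y rate Q0 Q1 K x y * (h y - h x).

(** [inord] makes the move total. It is faithful when [x] is valid, [i != j] and state [i] is
    occupied. *)
Definition transfer x i j : config d N :=
  [ffun k => inord (if k == i then (x k).-1 else if k == j then (x k).+1 else x k)].

Lemma valid_le2 x i j : valid_config x -> i != j -> (x i + x j <= N)%N.
Proof.
move=> /eqP vx ij; rewrite -[leqRHS]vx (bigD1 i) //= (bigD1 j) //= 1?eq_sym //.
by rewrite addnA leq_addr.
Qed.

Lemma transferE x i j k : valid_config x -> i != j -> (0 < x i)%N ->
  (transfer x i j k : nat) = if k == i then (x k).-1 else if k == j then (x k).+1 else x k.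
Proof.
move=> vx ij xi; rewrite ffunE inordK //.
have := valid_le2 vx ij; have := ltn_ord (x k).
by case: eqVneq => [->|_]; [lia | case: eqVneq => [->|_]; lia].
Qed.

Lemma jumpE x y i j : valid_config x ->
  jump x i j y = [&& i != j, (0 < x i)%N & y == transfer x i j].
Proof.
move=> vx; rewrite /jump; have [//|ij] /= := eqVneq i j.
have [xi|] := ltnP 0 (x i); last first.
  by rewrite leqn0 => /eqP ->.
apply/idP/eqP => [/and3P[/eqP hi /eqP hj /forallP hk]|->].
  apply/ffunP => k; apply/val_inj; rewrite /= transferE //.
  case: eqVneq => [->|ki]; first by rewrite -hi.
  case: eqVneq => [->//|kj].
  by have := hk k; rewrite ki kj => /eqP.
have ji : j != i by rewrite eq_sym.
rewrite !transferE // !eqxx (negbTE ji) prednK // !eqxx /=.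
by apply/forallP => k; apply/implyP => /andP[/negbTE ki /negbTE kj]; rewrite transferE // ki kj.
Qed.

Lemma valid_transfer x i j : valid_config x -> i != j -> (0 < x i)%N ->
  valid_config (transfer x i j).
Proof.
move=> vx ij xi; move: (vx) => /eqP vx'; rewrite /valid_config -[X in _ == X]vx'.
have ji : j != i by rewrite eq_sym.
rewrite (bigD1 i) //= (bigD1 j) //= [X in _ == X](bigD1 i) //= [X in _ == (_ + X)%N](bigD1 j) //=.
rewrite !transferE // !eqxx (negbTE ji).
rewrite (eq_bigr (fun k => (x k : nat))); last first.
  by move=> k /andP[/negbTE ki /negbTE kj]; rewrite transferE // ki kj.
by apply/eqP; lia.
Qed.

Lemma jrate0 x i j : (x i : nat) = 0%N -> jrate x i j = 0.
Proof. by move=> xi; rewrite /jrate /nactive xi min0n sub0n !mul0r addr0. Qed.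

(** For fixed [i] and [j] at most one target is possible. When state [i] is empty the rate is 0, so
    the spurious value of [transfer] is harmless. *)
Lemma genE h x : valid_config x ->
  gen h x = \sum_i \sum_(j | j != i) jrate x i j * (h (transfer x i j) - h x).
Proof.
move=> vx; rewrite /gen /rate.
under eq_bigr => y _ do rewrite mulr_suml.
rewrite exchange_big; apply: eq_bigr => i _ /=.
under eq_bigr => y _ do rewrite mulr_suml big_mkcond.
rewrite exchange_big [RHS]big_mkcond; apply: eq_bigr => j _ /=.
rewrite -big_mkcond (eq_bigl _ _ (fun y => jumpE y i j vx)) eq_sym.
have [//|ij] /= := eqVneq i j; first by rewrite big_pred0.
have [xi|] := ltnP 0 (x i); last first.
  by rewrite leqn0 => /eqP /jrate0 ->; rewrite big_pred0 // mul0r.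
by rewrite big_pred1_eq.
Qed.

(** Global balance tested against [h]: inflow and outflow at each configuration are multiplied by
    the same value of [h]. *)
Lemma stationary_gen (p : config d N -> R) h : stationary Q0 Q1 K p ->
  \sum_x p x * gen h x = 0.
Proof.
move=> [_ _ _ bal]; rewrite /gen.
have -> : \sum_x p x * (\sum_y rate Q0 Q1 K x y * (h y - h x)) =
   \sum_y (h y * \sum_(x | x != y) p x * rate Q0 Q1 K x y)
   - \sum_x (h x * (p x * \sum_(y | y != x) rate Q0 Q1 K x y)).
  transitivity (\sum_x \sum_(y | y != x) p x * rate Q0 Q1 K x y * h y
      - \sum_x (h x * (p x * \sum_(y | y != x) rate Q0 Q1 K x y))); last first.
    congr (_ - _); rewrite (exchange_big_dep xpredT) //=; apply: eq_bigr => y _.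
    rewrite mulr_sumr; apply: eq_big => [x|x _]; first by rewrite eq_sym.
    by rewrite mulrC.
  rewrite -sumrB; apply: eq_bigr => x _.
  rewrite (bigD1 x) //= subrr mulr0 add0r !mulr_sumr -sumrB.
  by apply: eq_bigr => y _; ring.
by rewrite -sumrB big1 // => y _; rewrite bal subrr.
Qed.

Hypotheses (g0 : generator Q0) (g1 : generator Q1).

Lemma jrate_ge0 x i j : i != j -> 0 <= jrate x i j.
Proof. by move=> ij; rewrite addr_ge0 // mulr_ge0 //; [exact: g1.1 | exact: g0.1]. Qed.

(** This is what makes uniformization at rate [Lam * N] legitimate. *)
Lemma jrate_sum_le x :
  \sum_i \sum_(j | j != i) jrate x i j <= Lam Q0 Q1 * N%:R.
Proof.
rewrite /Lam mulrDl mul1r ler_wpDr // mulr_suml ler_sum // => i _.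
rewrite mulr_suml [leRHS](bigID (fun j => j != i)) /= ler_wpDr //.
  by rewrite sumr_ge0 // => j _; rewrite mulr_ge0 // addr_ge0.
apply: ler_sum => j _; rewrite mulrC mulrDr addrC.
have xN : (x i <= N)%N by have := ltn_ord (x i).
apply: lerD; apply: (le_trans (ler_norm _)); rewrite normrM ger0_norm // ler_wpM2r // ler_nat.
  exact: leq_trans (geq_minl _ _) xN.
exact: leq_trans (leq_subr _ _) xN.
Qed.

Variable alpha : R.
Hypotheses (N0 : (0 < N)%N) (KN : K%:R = alpha * N%:R).

Lemma empirical_simplex x : valid_config x -> in_simplex (empirical x).
Proof.
move=> /eqP vx; split=> [i|]; first by rewrite divr_ge0.
by rewrite -mulr_suml -natr_sum vx divff // pnatr_eq0 -lt0n.
Qed.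

Lemma natrB_max (a b : nat) : (a - b)%:R = Num.max 0 (a%:R - b%:R) :> R.
Proof.
have [ab|ab] := leqP a b.
  rewrite max_l; last by rewrite subr_le0 ler_nat.
  by move: ab; rewrite -subn_eq0 => /eqP ->.
by rewrite max_r ?natrB ?subr_ge0 ?ler_nat // ltnW.
Qed.

(** Truncated subtraction is the [max] with 0, and [min] and [max] commute with scaling by [N], so
    the priority rule is exact at finite [N]. *)
Lemma nactive_active x i :
  (nactive K x i)%:R = N%:R * active alpha (empirical x) i.
Proof.
have NR : 0 < N%:R :> R by rewrite ltr0n.
rewrite /nactive /active -minEnat natr_min natrB_max KN natr_sum minr_pMr ?ler0n //.
rewrite maxr_pMr ?ler0n // mulr0 mulrBr /empirical /below mulrCA divff ?gt_eqF // mulr1.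
rewrite mulr_sumr; congr (Num.min _ (Num.max _ (_ - _))); first by rewrite mulrC.
by apply: eq_bigr => k _; rewrite mulrCA divff ?gt_eqF // mulr1.
Qed.

Lemma jrate_active x i j : jrate x i j =
  N%:R * (active alpha (empirical x) i * Q1 i j
          + (empirical x i - active alpha (empirical x) i) * Q0 i j).
Proof.
have NR : 0 < N%:R :> R by rewrite ltr0n.
rewrite /jrate natrB ?geq_minl // nactive_active.
have -> : (x i)%:R = N%:R * empirical x i by rewrite mulrCA divff ?gt_eqF // mulr1.
ring.
Qed.

(** Each jump contributes a difference of indicators, so the terms with [j = i] can be added freely.
    Zero row sums then cancel the outflow indicator, leaving column [k]. *)
Lemma gen_coord x k : valid_config x ->
  \sum_i \sum_(j | j != i) jrate x i j * ((transfer x i j k)%:R - (x k)%:R)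
  = N%:R * drift Q0 Q1 alpha (empirical x) k.
Proof.
move=> vx.
have rs i : \sum_j jrate x i j = 0.
  by rewrite big_split /= -!mulr_sumr g0.2 g1.2 !mulr0 addr0.
have E i j : j != i -> jrate x i j * ((transfer x i j k)%:R - (x k)%:R)
    = jrate x i j * ((k == j)%:R - (k == i)%:R).
  move=> ji; have [xi|] := ltnP 0 (x i); last first.
    by rewrite leqn0 => /eqP /jrate0 ->; rewrite !mul0r.
  congr (_ * _); rewrite transferE // 1?eq_sym //.
  case: (eqVneq k i) => [->|ki].
    by rewrite [i == j]eq_sym (negbTE ji) -subn1 natrB // mulr1n mulr0n; ring.
  case: (eqVneq k j) => [->|kj]; last by rewrite mulr0n; ring.
  by rewrite -[(x j).+1%:R]natr1 mulr1n mulr0n; ring.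
transitivity (\sum_i \sum_j jrate x i j * ((k == j)%:R - (k == i)%:R)).
  apply: eq_bigr => i _; rewrite [RHS](bigD1 i) //= subrr mulr0 add0r.
  by apply: eq_bigr => j; exact: E.
rewrite mulr_sumr; apply: eq_bigr => i _.
rewrite -jrate_active.
under eq_bigr => j _ do rewrite mulrBr.
rewrite sumrB -mulr_suml rs mul0r subr0 (bigD1 k) //= eqxx mulr1 big1 ?addr0 // => j.
by rewrite eq_sym => /negbTE ->; rewrite mulr0.
Qed.

End Jumps.

(** * Concentration of the uniformized chain *)

(** Invert [1 - w <= expR (- w)] and bound the resulting geometric fraction. *)
Lemma expR_le_quad (R : realType) (w : R) : `|w| <= 1 / 2 ->
  expR w <= 1 + w + 2 * w ^+ 2.
Proof.
rewrite ler_norml => /andP[w1 w2].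
have h : 0 < 1 - w by lra.
have -> : expR w = (expR (- w))^-1 by rewrite expRN invrK.
apply: (@le_trans _ _ (1 - w)^-1).
  by rewrite lef_pV2 ?posrE ?expR_gt0 // expR_ge1Dx.
by rewrite -[_^-1]mul1r ler_pdivrMr // expr2; nra.
Qed.

Section Chain.
Variables (R : realType) (d : nat) (Q0 Q1 : 'M[R]_d) (N K : nat) (alpha : R).
Hypotheses (g0 : generator Q0) (g1 : generator Q1).
Hypotheses (N0 : (0 < N)%N) (KN : K%:R = alpha * N%:R).
Implicit Types (x y z : config d N) (i j k : 'I_d) (h : config d N -> R).
Local Notation Lam := (Lam Q0 Q1).
Local Notation gen := (gen Q0 Q1 K).
Local Notation jrate := (jrate Q0 Q1 K).
Local Notation drift := (drift Q0 Q1 alpha).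
Local Notation emp := (@empirical R d N).
Local Notation estep := (estep Q0 Q1 alpha).

Let NR : 0 < N%:R :> R. Proof. by rewrite ltr0n. Qed.
Let LN : 0 < Lam * N%:R. Proof. by rewrite mulr_gt0 ?Lam_gt0. Qed.

(** One step of the uniformized chain, acting on functions; on valid configurations [transitionE]
    shows it to be an average. *)
Definition transition h x : R := h x + gen h x / (Lam * N%:R).

Lemma transitionE h x : valid_config x -> transition h x =
  (1 - (\sum_i \sum_(j | j != i) jrate x i j) / (Lam * N%:R)) * h x
  + (\sum_i \sum_(j | j != i) jrate x i j * h (transfer x i j)) / (Lam * N%:R).
Proof.
move=> vx; rewrite /transition genE //.
have -> : \sum_i \sum_(j | j != i) jrate x i j * (h (transfer x i j) - h x)
   = \sum_i \sum_(j | j != i) jrate x i j * h (transfer x i j)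
     - (\sum_i \sum_(j | j != i) jrate x i j) * h x.
  rewrite mulr_suml -sumrB; apply: eq_bigr => i _.
  by rewrite mulr_suml -sumrB; apply: eq_bigr => j _; rewrite mulrBr.
ring.
Qed.

Lemma transition_le h h' x : valid_config x -> h x <= h' x ->
  (forall i j, i != j -> (0 < x i)%N -> h (transfer x i j) <= h' (transfer x i j)) ->
  transition h x <= transition h' x.
Proof.
move=> vx hx hm; rewrite !transitionE //; apply: lerD.
  rewrite ler_wpM2l // subr_ge0 ler_pdivrMr // mul1r.
  exact: jrate_sum_le.
rewrite ler_wpM2r ?invr_ge0 ?(ltW LN) //; apply: ler_sum => i _.
apply: ler_sum => j ji; rewrite eq_sym in ji.
have [xi|] := ltnP 0 (x i); last first.
  by rewrite leqn0 => /eqP /jrate0 ->; rewrite !mul0r.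
by rewrite ler_wpM2l ?jrate_ge0 // hm.
Qed.

Lemma transition_cst (c : R) : transition (fun=> c) = fun=> c.
Proof.
by apply/funext => x; rewrite /transition /gen big1 ?mul0r ?addr0 // => y _; rewrite subrr mulr0.
Qed.

Lemma transitionZ (c : R) h : transition (fun y => c * h y) = fun x => c * transition h x.
Proof.
apply/funext => x; rewrite /transition mulrDr mulrA; congr (_ + _ * _).
by rewrite mulr_sumr; apply: eq_bigr => y _; ring.
Qed.

Lemma transitionD h h' :
  transition (fun y => h y + h' y) = fun x => transition h x + transition h' x.
Proof.
apply/funext => x; rewrite /transition addrACA -mulrDl -big_split; congr (_ + _ * _).
by apply: eq_bigr => y _ /=; ring.
Qed.

Lemma iter_transition_cst n (c : R) : iter n transition (fun=> c) = fun=> c.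
Proof. by elim: n => //= n ->; rewrite transition_cst. Qed.

Lemma iter_transitionZ n (c : R) h :
  iter n transition (fun y => c * h y) = fun x => c * iter n transition h x.
Proof. by elim: n => //= n ->; rewrite transitionZ. Qed.

Lemma iter_transitionD n h h' :
  iter n transition (fun y => h y + h' y) = fun x => iter n transition h x + iter n transition h' x.
Proof. by elim: n => //= n ->; rewrite transitionD. Qed.

Lemma iter_transition_sum n (I : Type) (r : seq I) (F : I -> config d N -> R) :
  iter n transition (fun y => \sum_(a <- r) F a y)
  = fun x => \sum_(a <- r) iter n transition (F a) x.
Proof.
elim: r => [|a r IH].
  under eq_fun do rewrite big_nil.
  by rewrite iter_transition_cst; apply/funext => x; rewrite big_nil.
under eq_fun do rewrite big_cons.
by rewrite iter_transitionD IH; apply/funext => x; rewrite big_cons.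
Qed.

Lemma iter_transition_le n h h' x : valid_config x ->
  (forall y, valid_config y -> h y <= h' y) ->
  iter n transition h x <= iter n transition h' x.
Proof.
move=> vx hh; elim: n x vx => [|n IH] x vx /=; first exact: hh.
by apply: transition_le => // [|i j ij xi]; apply: IH => //; exact: valid_transfer.
Qed.

Lemma stationary_transition n (p : config d N -> R) h : stationary Q0 Q1 K p ->
  \sum_x p x * iter n transition h x = \sum_x p x * h x.
Proof.
move=> sp; elim: n => //= n <-.
have e : \sum_x p x * (gen (iter n transition h) x / (Lam * N%:R)) = 0.
  under eq_bigr do rewrite mulrA.
  by rewrite -mulr_suml stationary_gen // mul0r.
transitivity (\sum_x p x * iter n transition h x
    + \sum_x p x * (gen (iter n transition h) x / (Lam * N%:R))); last by rewrite e addr0.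
by rewrite -big_split; apply: eq_bigr => x _; rewrite /= -mulrDr.
Qed.

(** Expand the exponential to second order. The first-order part is the drift by [gen_coord]. A jump
    changes a coordinate by at most one, so the total rate controls the rest, and [1 + z <= expR z]
    restores a product form that can be iterated. *)
Lemma transition_exp x k (t : R) : valid_config x -> `|t| <= 1 / 2 ->
  transition (fun y => expR (t * (y k)%:R)) x <=
  expR (t * (x k)%:R) * expR (t * drift (emp x) k / Lam + 2 * t ^+ 2).
Proof.
move=> vx t2; set u := expR (t * _); rewrite /transition genE // -/u.
have u0 : 0 < u by exact: expR_gt0.
apply: (@le_trans _ _ (u * (1 + (t * drift (emp x) k / Lam + 2 * t ^+ 2)))); last first.
  by rewrite ler_wpM2l ?(ltW u0) // expR_ge1Dx.
rewrite mulrDr mulr1 lerD2l ler_pdivrMr //.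
have -> : u * (t * drift (emp x) k / Lam + 2 * t ^+ 2) * (Lam * N%:R)
  = u * (t * (N%:R * drift (emp x) k) + 2 * t ^+ 2 * (Lam * N%:R)).
  by field; rewrite gt_eqF // Lam_gt0.
rewrite -(gen_coord g0 g1 N0 KN k vx).
apply: (@le_trans _ _ (u * (t * (\sum_i \sum_(j | j != i)
     jrate x i j * ((transfer x i j k)%:R - (x k)%:R))
   + 2 * t ^+ 2 * \sum_i \sum_(j | j != i) jrate x i j))); last first.
  have tt : 0 <= 2 * t ^+ 2 by apply: mulr_ge0 => //; exact: sqr_ge0.
  rewrite ler_wpM2l ?(ltW u0) // lerD2l ler_wpM2l //.
  exact: jrate_sum_le.
rewrite !mulr_sumr -big_split mulr_sumr; apply: ler_sum => i _ /=.
rewrite !mulr_sumr -big_split mulr_sumr; apply: ler_sum => j ji /=.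
have ij : i != j by rewrite eq_sym.
have [xi|] := ltnP 0 (x i); last first.
  by rewrite leqn0 => /eqP /jrate0 ->; rewrite !(mul0r,mulr0) addr0 mulr0.
set D := (transfer x i j k)%:R - (x k)%:R.
have D1 : `|D| <= 1.
  rewrite /D transferE //; case: eqVneq => [->|_].
    by rewrite -subn1 natrB // ler_norml; apply/andP; split; lra.
  case: eqVneq => [->|_]; last by rewrite subrr normr0.
  by rewrite -natr1 ler_norml; apply/andP; split; lra.
have -> : expR (t * (transfer x i j k)%:R) = u * expR (t * D).
  by rewrite -expRD; congr expR; rewrite /D; ring.
have e1 : expR (t * D) <= 1 + t * D + 2 * (t * D) ^+ 2.
  apply: expR_le_quad; rewrite normrM -[leRHS]mulr1.
  by rewrite ler_pM.
have e2 : (t * D) ^+ 2 <= t ^+ 2.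
  by rewrite exprMn ler_piMr ?sqr_ge0 // -real_normK ?num_real // exprn_ile1.
have r0 := jrate_ge0 K g0 g1 x ij.
rewrite (_ : u * (_ + _) = jrate x i j * (u * (t * D + 2 * t ^+ 2))); last by ring.
rewrite ler_wpM2l // -[X in _ - X]mulr1 -mulrBr ler_wpM2l ?(ltW u0) //; lra.
Qed.

Definition within n x z := forall i, (x i <= z i + n)%N && (z i <= x i + n)%N.

Lemma within_transfer n x z i j : valid_config z -> i != j -> (0 < z i)%N ->
  within n x z -> within n.+1 x (transfer z i j).
Proof.
move=> vz ij zi w k; have := w k; rewrite transferE //.
by case: eqVneq => [->|_]; [|case: eqVneq => _]; lia.
Qed.

Lemma within_emp n x z i : within n x z -> `|emp z i - emp x i| <= n%:R / N%:R.
Proof.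
move=> /(_ i); rewrite -!(ler_nat R) !natrD => /andP[h1 h2].
rewrite -mulrBl normrM [`|_^-1|]ger0_norm ?invr_ge0 ?(ltW NR) //.
by rewrite ler_wpM2r ?invr_ge0 ?(ltW NR) // ler_norml; apply/andP; split; lra.
Qed.

(* During [n] steps the chain moves by at most [n / N], so that the drift is
   almost constant. *)
Lemma iter_transition_exp n x k (t : R) : valid_config x -> `|t| <= 1 / 2 ->
  iter n transition (fun y => expR (t * (y k)%:R)) x <= expR (t * (x k)%:R) *
    expR (n%:R * (t * drift (emp x) k / Lam + `|t| * d.+2%:R * (n%:R / N%:R) + 2 * t ^+ 2)).
Proof.
move=> vx t2; set ka := (X in _ * expR (_ * X)).
(* Here [m] steps are already made and [j] remain; [m + j <= n] keeps every visited configuration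
   within [n] of [x]. *)
suff H (j : nat) : forall m z, valid_config z -> within m x z -> (m + j <= n)%N ->
    iter j transition (fun y => expR (t * (y k)%:R)) z <= expR (t * (z k)%:R) * expR (j%:R * ka).
  by apply: (H n 0%N) => // i; rewrite !addn0 leqnn.
elim: j => [|j IH] m z vz w mj.
  by rewrite mul0r expR0 mulr1.
rewrite iterS; set u := (fun y : config d N => expR (t * (y k)%:R)) in IH *.
apply: le_trans (_ : transition (fun y => expR (j%:R * ka) * u y) z <= _).
  apply: transition_le => // [|i l il zi]; rewrite mulrC.
    by apply: (IH m) => //; lia.
  by apply: (IH m.+1); [exact: valid_transfer|exact: within_transfer|lia].
rewrite transitionZ -natr1 mulrDl mul1r expRD mulrCA.
rewrite ler_wpM2l ?expR_ge0 //; apply: le_trans (transition_exp k vz t2) _.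
rewrite ler_wpM2l ?expR_ge0 // ler_expR /ka lerD2r.
have wn : within n x z by move=> i; have := w i; lia.
have := drift_lip Q0 Q1 alpha k (fun i => within_emp i wn).
set D := drift (emp z) k; set D' := drift (emp x) k => hD.
have L0 := Lam_gt0 Q0 Q1.
rewrite -lerBlDl -mulrBl -mulrBr ler_pdivrMr //.
apply: le_trans (ler_norm _) _; rewrite normrM -!mulrA ler_wpM2l //.
by apply: le_trans hD _; rewrite /Lip le_eqVlt; apply/orP; left; apply/eqP; ring.
Qed.

End Chain.

(** * Batches of transitions as Euler steps *)

Section Batch.
Variables (R : realType) (d : nat) (Q0 Q1 : 'M[R]_d) (N K : nat) (alpha : R).
Hypotheses (g0 : generator Q0) (g1 : generator Q1).
Hypotheses (N0 : (0 < N)%N) (KN : K%:R = alpha * N%:R).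
Variable M : nat.
Hypotheses (M0 : (0 < M)%N) (MN : (M ^ 2 <= N)%N).
Implicit Types (x y z : config d N) (i j k : 'I_d) (h : config d N -> R).
Local Notation Lam := (Lam Q0 Q1).
Local Notation drift := (drift Q0 Q1 alpha).
Local Notation emp := (@empirical R d N).
Local Notation estep := (estep Q0 Q1 alpha d.+4%:R M).
Local Notation batch := (iter (N %/ M) (transition Q0 Q1 K)).

Let NR : 0 < N%:R :> R. Proof. by rewrite ltr0n. Qed.
Let MR : 0 < M%:R :> R. Proof. by rewrite ltr0n. Qed.
Let MNR : M%:R ^+ 2 <= N%:R :> R. Proof. by rewrite -natrX ler_nat. Qed.

Lemma estepPn x y : valid_config x -> ~ estep (emp x) (emp y) ->
  exists k, N%:R * d.+3%:R / M%:R ^+ 2 <=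
    `|(y k)%:R - (x k)%:R - (N %/ M)%N%:R * (drift (emp x) k / Lam)|.
Proof.
move=> vx /existsNP [k /negP]; rewrite -ltNge => hk; exists k.
have := drift_bound Q0 Q1 alpha k (empirical_simplex _ N0 vx).
set D := drift _ _ in hk * => hD.
have L0 := Lam_gt0 Q0 Q1.
have hE : `|D / Lam| <= 1.
  by rewrite normrM normfV (gtr0_norm L0) ler_pdivrMr // mul1r.
have EE : D / (M%:R * Lam) = D / Lam / M%:R by field; rewrite !gt_eqF.
rewrite EE in hk; move: hE hk; set E := D / Lam => hE hk.
have n1 : (N %/ M)%N%:R * M%:R <= N%:R :> R by rewrite -natrM ler_nat leq_divM.
have n2 : N%:R <= ((N %/ M)%N%:R + 1) * M%:R :> R.
  by rewrite natr1 -natrM ler_nat ltnW // ltn_ceil.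
set n := (N %/ M)%N%:R in n1 n2 *.
(* Rounding [N / M] down costs at most 1, which [M ^ 2 <= N] bounds by [N / M ^ 2]. This uses up one
   unit of the constant [d.+4]. *)
have hr : `|(N%:R / M%:R - n) * E| <= N%:R / M%:R ^+ 2.
  rewrite normrM -[leRHS]mulr1; apply: ler_pM => //.
  apply: (@le_trans _ _ 1); last by rewrite ler_pdivlMr ?exprn_gt0 // mul1r.
  rewrite ler_norml -(lerD2r n) -[X in _ && X](lerD2r n) subrK ler_pdivrMr // ler_pdivlMr //.
  by apply/andP; split; nra.
have : N%:R * (d.+4%:R / M%:R ^+ 2) < N%:R * `|emp y k - emp x k - E / M%:R|.
  by rewrite ltr_pM2l.
rewrite -[X in X * `|_|](gtr0_norm NR) -normrM.
have -> : N%:R * (emp y k - emp x k - E / M%:R) =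
    ((y k)%:R - (x k)%:R - n * E) - (N%:R / M%:R - n) * E.
  by rewrite /empirical; field; rewrite !gt_eqF.
set W := _ - n * E => h1.
have := le_lt_trans (lexx _) (lt_le_trans h1 (ler_normB _ _)).
rewrite -[d.+4%:R]natr1 mulrDl mulrDr mul1r mulrA; lra.
Qed.

(** An exponential Markov inequality with a union bound over the [d] coordinates and the two signs
    of the deviation. *)
Lemma batch_fail x : valid_config x ->
  batch (fun y => (~~ `[< estep (emp x) (emp y) >])%:R) x
    <= 2 * d%:R * expR (- (N%:R / (8 * M%:R ^+ 3))).
Proof.
move=> vx; set n := (N %/ M)%N.
(* This minimizes [- th / M ^ 2 + 2 * th ^ 2 / M], the exponent per bandit once the [d.+2] part of
   the threshold has absorbed the variation of the drift. The minimum is [- 1 / (8 * M ^ 3)]. *)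
pose th : R := 1 / (4 * M%:R).
have th0 : 0 < th by rewrite divr_gt0 // mulr_gt0.
have M1 : 1 <= M%:R :> R by rewrite ler1n.
have th1 : th <= 1 / 2 by rewrite ler_pdivrMr ?mulr_gt0 //; lra.
pose a : R := th * (N%:R * d.+3%:R / M%:R ^+ 2).
pose t (s : bool) : R := (-1) ^+ s * th.
have tn s : `|t s| = th by rewrite normrMsign gtr0_norm.
(* Normalized so that the weighted exponential is at least 1 when coordinate [k] deviates with sign
   [s] beyond the threshold. *)
pose c k s := expR (- (t s * (x k)%:R) - n%:R * (t s * (drift (emp x) k / Lam)) - a).
apply: (@le_trans _ _ (batch (fun y => \sum_k \sum_(s : bool) c k s * expR (t s * (y k)%:R)) x)).
  apply: iter_transition_le => // y _.
  have S0 (k : 'I_d) : 0 <= \sum_(s : bool) c k s * expR (t s * (y k)%:R).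
    by apply: sumr_ge0 => s _; rewrite mulr_ge0 ?expR_ge0.
  case: asboolP => [_|] /=; first by rewrite sumr_ge0.
  move=> /(estepPn vx) [k]; rewrite -/n; set W := (X in `|X|) => hW.
  rewrite (bigD1 k) //= ler_wpDr ?sumr_ge0 //.
  rewrite (bigD1 (W < 0)) //= ler_wpDr ?sumr_ge0 // => [s _|].
    by rewrite mulr_ge0 ?expR_ge0.
  rewrite /c -expRD; set z := (X in expR X).
  suff z0 : 0 <= z by apply: le_trans (expR_ge1Dx z); rewrite lerDl.
  have -> : z = th * ((-1) ^+ (W < 0)%R * W) - a by rewrite /z /t /W; ring.
  by rewrite -normrEsign /a -mulrBr mulr_ge0 ?(ltW th0) // subr_ge0.
set be := expR _.
have -> : 2 * d%:R * be = \sum_(k < d) (be + be).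
  by rewrite sumr_const card_ord -[RHS]mulr_natl; ring.
rewrite iter_transition_sum; apply: ler_sum => k _; rewrite iter_transition_sum big_bool /=.
suff H s : batch (fun y => c k s * expR (t s * (y k)%:R)) x
    <= be by apply: lerD; exact: H.
rewrite iter_transitionZ.
have ts : `|t s| <= 1 / 2 by rewrite tn.
apply: le_trans (ler_wpM2l (expR_ge0 _) (iter_transition_exp g0 g1 N0 KN n k vx ts)) _.
rewrite /c /be -!expRD ler_expR tn.
have -> : t s ^+ 2 = th ^+ 2 by rewrite -[t s ^+ 2]real_normK ?num_real // tn.
set D := drift _ _.
rewrite [leLHS](_ : _ = n%:R * (th * d.+2%:R * (n%:R / N%:R) + 2 * th ^+ 2) - a); last by ring.
have n1 : n%:R * M%:R <= N%:R :> R by rewrite -natrM ler_nat leq_divM.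
have n2 : n%:R <= N%:R / M%:R :> R by rewrite ler_pdivlMr.
have n0 : 0 <= n%:R :> R by [].
have n3 : n%:R * (n%:R / N%:R) <= N%:R / M%:R ^+ 2 :> R.
  have -> : N%:R / M%:R ^+ 2 = (N%:R / M%:R) * (N%:R / M%:R / N%:R) :> R.
    by field; rewrite !gt_eqF.
  by apply: ler_pM; rewrite ?divr_ge0 // ler_wpM2r // invr_ge0.
apply: (@le_trans _ _ (th * d.+2%:R * (N%:R / M%:R ^+ 2) + 2 * th ^+ 2 * (N%:R / M%:R) - a)).
  rewrite lerD2r mulrDr; apply: lerD.
    by rewrite mulrCA ler_wpM2l // mulr_ge0 // ltW.
  by rewrite mulrC ler_wpM2l // mulr_ge0 // sqr_ge0.
rewrite /a /th -[d.+3%:R]natr1 le_eqVlt; apply/orP; left; apply/eqP.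
by field; rewrite !gt_eqF.
Qed.

(** Only approximate Euler steps between valid configurations are required, whether or not the chain
    can follow them. *)
Fixpoint reach (L : nat) x y : Prop :=
  if L is L'.+1 then exists w, [/\ valid_config w, estep (emp x) (emp w) & reach L' w y]
  else y = x.

Lemma reach_pseudo L x y : valid_config x -> reach L x y ->
  exists u : nat -> 'I_d -> R,
    [/\ pseudo_traj Q0 Q1 alpha d.+4%:R M u, u 0%N = emp x & u L = emp y].
Proof.
have L0 := Lam_gt0 Q0 Q1.
have M1 : 1 <= M%:R :> R by rewrite ler1n.
elim: L x => [|L IH] x vx /= => [->|[w [vw xw /(IH w vw) [u [[us ue] u0 uL]]]]].
  (* A pseudo-trajectory is infinite, so the finite path is continued by exact Euler steps. *)
  pose f m j := m j + 1 / (M%:R * Lam) * drift m j.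
  have h0 : 0 <= 1 / (M%:R * Lam) by rewrite divr_ge0 // mulr_ge0 // ltW.
  exists (fun k : nat => iter k f (emp x)); split=> //; split=> [k|k i].
    elim: k => [|k IH]; first exact: empirical_simplex.
    apply: euler_simplex => //.
    by rewrite mulr_ge0 ?(ltW L0) //= mul1r invfM divfK ?gt_eqF // invf_le1.
  rewrite iterS /f; set m := iter k _ _.
  rewrite (_ : _ - _ = 0) ?normr0 ?divr_ge0 ?exprn_ge0 //; ring.
exists (fun k : nat => if k is k'.+1 then u k' else emp x); split=> //; split=> [[|k]|[|k]] //=.
  exact: empirical_simplex.
by rewrite u0.
Qed.

(** A union bound over batches: condition on the first one, use induction if it is an Euler step,
    and bound by 1 otherwise. *)
Lemma batch_iter_le L (b : config d N -> bool) x : valid_config x ->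
  (forall y, valid_config y -> reach L x y -> ~~ b y) ->
  iter L batch (fun y => (b y)%:R) x
    <= L%:R * (2 * d%:R * expR (- (N%:R / (8 * M%:R ^+ 3)))).
Proof.
set be := 2 * _ * _.
have be0 : 0 <= be by rewrite !mulr_ge0 ?expR_ge0.
have le1 : forall L' w, valid_config w -> iter L' batch (fun y => (b y)%:R) w <= 1.
  elim=> [|L' IH] w vw /=; first by case: (b w).
  apply: (@le_trans _ _ (batch (fun=> 1) w)); first exact: iter_transition_le.
  by rewrite iter_transition_cst.
elim: L x => [|L IH] x vx hr /=.
  by rewrite mul0r (negbTE (hr x vx erefl)).
apply: (@le_trans _ _ (batch (fun w => L%:R * be + (~~ `[< estep (emp x) (emp w) >])%:R) x)).
  apply: iter_transition_le => // w vw; case: asboolP => /= [xw|_].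
    by rewrite addr0; apply: IH => // y vy wy; apply: hr => //; exists w.
  by apply: le_trans (le1 L w vw) _; rewrite lerDr mulr_ge0.
rewrite iter_transitionD iter_transition_cst -[L.+1%:R]natr1 mulrDl mul1r lerD2l.
exact: batch_fail.
Qed.

(** The bound is uniform in the starting configuration, so it can be averaged under [p], which [L]
    batches leave invariant. *)
Lemma stationary_batch_le (p : config d N -> R) L (b : config d N -> bool) :
  stationary Q0 Q1 K p ->
  (forall x y, valid_config x -> valid_config y -> reach L x y -> ~~ b y) ->
  \sum_x p x * (b x)%:R <= L%:R * (2 * d%:R * expR (- (N%:R / (8 * M%:R ^+ 3)))).
Proof.
move=> sp hb; set be := (X in _ <= X).
have -> : \sum_x p x * (b x)%:R = \sum_x p x * iter L batch (fun y => (b y)%:R) x.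
  by elim: L {hb be} => //= L ->; rewrite (stationary_transition _ _ sp).
have [p0 pv p1 _] := sp.
rewrite -[be]mul1r -[X in _ <= X * _]p1 mulr_suml; apply: ler_sum => x _.
have [vx|nvx] := boolP (valid_config x); last by rewrite pv // !mul0r.
rewrite ler_wpM2l //; apply: batch_iter_le => // y; exact: hb.
Qed.

End Batch.

(** * Stationary mean near the equilibrium *)

Section Local.
Variables (R : realType) (d : nat) (Q0 Q1 : 'M[R]_d) (alpha : R).
Hypotheses (g0 : generator Q0) (g1 : generator Q1) (ha : 0 < alpha < 1).
Implicit Types (m : 'I_d -> R) (i j s : 'I_d).
Local Notation drift := (drift Q0 Q1 alpha).
Local Notation adrift := (adrift Q0 Q1 alpha).
Local Notation Lam := (Lam Q0 Q1).

Lemma below_itv m i : in_simplex m -> 0 <= below m i <= 1.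
Proof.
move=> [m0 <-]; rewrite sumr_ge0 //= [leRHS](bigID (fun k : 'I_d => (k < i)%N)) /=.
by rewrite lerDl sumr_ge0.
Qed.

Lemma adrift_bound s m j : in_simplex m -> `|adrift s m j| <= 2 * Lam.
Proof.
move=> sm; apply: (@col_sum_le _ _ _ _ _ j) => // i.
(* Far from [mstar] the affine continuation may give a negative active mass, hence the factor 2. *)
have h : -1 <= aactive alpha s m i <= 1 /\ -2 <= m i - aactive alpha s m i <= 2.
  have m1 := simplex_le1 i sm; have [/(_ i) m0 _] := sm.
  have /andP[b0 b1] := below_itv s sm; case/andP: ha => a0 a1.
  by rewrite /aactive; case: ifP => _; [|case: ifP => _];
     split; apply/andP; split; lra.
case: h; rewrite -!ler_norml => h1 h2.
apply: le_trans (ler_normD _ _) _; rewrite !normrM mulrDr addrC.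
by apply: lerD; rewrite ler_wpM2r //; lra.
Qed.

(* The weights may be negative: [adrift s] is affine. *)
Lemma adrift_avg (T : finType) (p : T -> R) (f : T -> 'I_d -> R) s j :
  \sum_x p x = 1 ->
  adrift s (fun i => \sum_x p x * f x i) j = \sum_x p x * adrift s (f x) j.
Proof.
move=> p1; rewrite /adrift.
have E i : aactive alpha s (fun i => \sum_x p x * f x i) i
    = \sum_x p x * aactive alpha s (f x) i.
  rewrite /aactive; case: ifP => // _; case: ifP => _.
    rewrite /below exchange_big /= -[alpha in LHS]mul1r -[X in X * alpha]p1 mulr_suml -sumrB.
    by apply: eq_bigr => x _; rewrite mulrBr mulr_sumr.
  by rewrite big1 // => x _; rewrite mulr0.
under [RHS]eq_bigr do rewrite mulr_sumr.
rewrite exchange_big; apply: eq_bigr => i _ /=.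
rewrite E -sumrB !mulr_suml -big_split; apply: eq_bigr => x _ /=; ring.
Qed.

Lemma adrift_comb s m m' (t : R) j :
  adrift s (fun i => m i + t * (m' i - m i)) j = (1 - t) * adrift s m j + t * adrift s m' j.
Proof.
have := @adrift_avg bool (fun b => if b then t else 1 - t) (fun b => if b then m' else m) s j.
rewrite !big_bool /= => h; rewrite [RHS]addrC -h; last by ring.
by congr (adrift _ _ _); apply/funext => i; rewrite big_bool /=; ring.
Qed.

(** Nonsingularity makes both inequalities defining the partially activated state strict, so the
    same state serves in a whole neighbourhood. *)
Lemma nonsingular_affine mstar : in_simplex mstar -> ~ singular alpha mstar ->
  exists s r, 0 < r /\ forall m, in_simplex m ->
    (forall i, `|m i - mstar i| <= r) -> forall j, drift m j = adrift s m j.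
Proof.
move=> sm ns; have [s [_ /andP[h1 h2]]] := s_of_some ha sm.
(* Equality would exhaust the budget exactly at the predecessor of [s]; if [s] is the first state,
   it would give [alpha = 0]. *)
have h1' : below mstar s < alpha.
  rewrite lt_neqAle h1 andbT; apply/eqP => be; apply: ns.
  have [s0|s0] := posnP s.
    move: be ha; rewrite /below big1 => [<-|i]; last by rewrite s0.
    by rewrite ltxx.
  have hs : (s.-1 < d)%N by have := ltn_ord s; lia.
  exists (Ordinal hs); rewrite -be; apply: eq_bigl => i /=; lia.
(* The margin [g] is divided by [d.+1] since [below m s + m s] moves by at most [d.+1] times the
   radius. *)
pose g := Num.min (alpha - below mstar s) (below mstar s + mstar s - alpha).
have g_gt0 : 0 < g by rewrite lt_min !subr_gt0 h1'.
exists s, (g / d.+1%:R); split=> [|m sm' hm j]; first by rewrite divr_gt0.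
apply: drift_adrift; first by case: sm'.
have r0 : 0 <= g / d.+1%:R by rewrite divr_ge0 // ltW.
have := below_lip s r0 hm; have := hm s.
have : g / d.+1%:R + d%:R * (g / d.+1%:R) = g.
  by rewrite -[d.+1%:R]natr1; field; rewrite natr1 pnatr_eq0.
set e := g / _; set e' := d%:R * e => ge.
have e'0 : 0 <= e' by rewrite mulr_ge0.
have : g <= alpha - below mstar s by rewrite ge_min lexx.
have : g <= below mstar s + mstar s - alpha by rewrite ge_min lexx orbT.
rewrite !ler_norml; clear -ge e'0 r0; lra.
Qed.

(** Move [m] along its ray from [mstar] to sup distance [q], where the drift is affine and at least
    [gam] by [drift_away]. As the affine drift vanishes at [mstar], it scales linearly along the
    ray. *)
Lemma adrift_nondegenerate mstar s (r : R) : 0 < r -> in_simplex mstar ->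
  uniform_global_attractor Q0 Q1 alpha mstar ->
  (forall j, drift mstar j = 0) ->
  (forall m, in_simplex m -> (forall i, `|m i - mstar i| <= r) ->
     forall j, drift m j = adrift s m j) ->
  exists c, 0 < c /\ forall m, in_simplex m ->
    exists j, forall i, c * `|m i - mstar i| <= `|adrift s m j|.
Proof.
move=> r0 sm att dm haff.
have as0 j : adrift s mstar j = 0.
  by rewrite -haff // => i; rewrite subrr normr0 ltW.
(* Staying below the positive coordinates of [mstar] keeps the rescaled point in the simplex, even
   when the ray is extended beyond [m]. Where [mstar] is 0, the coordinate is a nonnegative multiple
   of that of [m]. *)
pose q := \big[Num.min/r]_(i | 0 < mstar i) mstar i.
have q0 : 0 < q by apply/bigmin_gtP; split.
have qr : q <= r by exact: bigmin_le_id.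
have qm i : 0 < mstar i -> q <= mstar i by move=> h; exact: bigmin_le_cond.
have [gam [gam0 hgam]] := drift_away g0 g1 ha q0 att.
exists (gam / q); split; first exact: divr_gt0.
move=> m sm'.
pose i0 := [arg max_(i > s) `|m i - mstar i|]%O.
have i0P i : `|m i - mstar i| <= `|m i0 - mstar i0|.
  by rewrite /i0; case: arg_maxP => // k _; apply.
set rho := `|m i0 - mstar i0| in i0P.
have [z|nz] := eqVneq rho 0.
  exists s => i; apply: (@le_trans _ _ 0) => //.
  by rewrite pmulr_rle0 ?divr_gt0 // -z.
have rho0 : 0 < rho by rewrite lt_neqAle eq_sym nz normr_ge0.
pose t := q / rho; have t0 : 0 < t by rewrite divr_gt0.
pose u i := mstar i + t * (m i - mstar i).
have ud i : `|u i - mstar i| = t * `|m i - mstar i|.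
  by rewrite /u addrC addKr normrM gtr0_norm.
have uq i : `|u i - mstar i| <= q.
  rewrite ud; apply: le_trans (ler_wpM2l (ltW t0) (i0P i)) _.
  by rewrite /t divfK.
have us : in_simplex u.
  have [s0 s1] := sm; have [m0 m1] := sm'; split=> [i|]; last first.
    by rewrite big_split /= s1 -mulr_sumr sumrB m1 s1 subrr mulr0 addr0.
  have := s0 i; rewrite le_eqVlt => /orP[/eqP z|p].
    by rewrite /u -z add0r subr0 mulr_ge0 // ltW.
  by have := uq i; have := qm i p; rewrite ler_norml; lra.
have [j hj] : exists j, gam <= `|drift u j|.
  by apply: hgam => //; exists i0; rewrite ud /t divfK.
exists j => i.
have := hj; rewrite haff //; last by move=> k; exact: le_trans (uq k) qr.
rewrite adrift_comb as0 mulr0 add0r normrM gtr0_norm // => {}hj.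
apply: le_trans (ler_wpM2l _ (i0P i)) _; first by rewrite divr_ge0 // ltW.
rewrite -/rho -(ler_pM2l t0); apply: le_trans hj.
rewrite le_eqVlt; apply/orP; left; apply/eqP.
by rewrite /t; field; rewrite nz lt0r_neq0.
Qed.

Lemma stationary_drift (N K : nat) (p : config d N -> R) j :
  (0 < N)%N -> K%:R = alpha * N%:R -> stationary Q0 Q1 K p ->
  \sum_x p x * drift (empirical R x) j = 0.
Proof.
move=> N0 KN sp.
have := stationary_gen (fun y => (y j)%:R) sp => h.
have [_ pv _ _] := sp.
apply: (@mulfI _ N%:R); first by rewrite pnatr_eq0 -lt0n.
rewrite mulr0 -[RHS]h mulr_sumr; apply: eq_bigr => x _.
have [vx|nvx] := boolP (valid_config x); last by rewrite pv // !mul0r mulr0.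
by rewrite mulrCA -(gen_coord g0 g1 N0 KN) // genE.
Qed.

End Local.

(** * The exponential bound on the stationary mean *)

Theorem mainTheorem11 (R : realType) (d : nat) (Q0 Q1 : 'M[R]_d)
  (r0 r1 : 'I_d -> R) (alpha : R) (mstar : 'I_d -> R) :
  generator Q0 -> generator Q1 ->
  0 < alpha < 1 ->
  unichain Q0 Q1 ->
  strictly_indexable_labeled Q0 Q1 r0 r1 ->
  in_simplex mstar ->
  (forall j, phi Q0 Q1 alpha mstar j = mstar j) ->
  (forall m, in_simplex m -> (forall j, phi Q0 Q1 alpha m j = m j) -> m = mstar) ->
  uniform_global_attractor Q0 Q1 alpha mstar ->
  ~ singular alpha mstar ->
  exists b c : R, 0 < b /\ 0 < c /\
    forall (N K : nat), (0 < N)%N -> K%:R = alpha * N%:R ->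
    forall p : config d N -> R, stationary Q0 Q1 K p ->
    forall i : 'I_d, `|expected_M p i - mstar i| <= b * expR (- (c * N%:R)).
Proof.
move=> g0 g1 ha _ _ sm fm _ att ns.
have dm j : drift Q0 Q1 alpha mstar j = 0.
  by rewrite -drift_phi // fm subrr mulr0.
have [s [r [r_gt0 haff]]] := nonsingular_affine Q0 Q1 ha sm ns.
have [c0 [c00 hc0]] := adrift_nondegenerate g0 g1 ha r_gt0 sm att dm haff.
have [M [L [M0 hL]]] := attract g0 g1 ha (ler0n R d.+4) r_gt0 att.
have MR : 0 < M%:R :> R by rewrite ltr0n.
have Lm0 := Lam_gt0 Q0 Q1.
(* [c] is the rate of [batch_fail]. In [b1], [3 * Lam] bounds the gap between the two drifts at a
   bad configuration and [c0] comes from nondegeneracy; [b2] makes the bound at least 1 when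
   [N < M ^ 2]. *)
pose c : R := 1 / (8 * M%:R ^+ 3).
pose b1 : R := 3 * Lam Q0 Q1 * (L%:R * (2 * d%:R)) / c0.
pose b2 := expR (c * M%:R ^+ 2).
have c_gt0 : 0 < c by rewrite divr_gt0 // mulr_gt0 // exprn_gt0.
have b10 : 0 <= b1.
  by rewrite divr_ge0 ?(ltW c00) // mulr_ge0 // mulr_ge0 // ltW.
exists (b1 + b2), c; split; first by rewrite ltr_wpDl ?expR_gt0.
split=> // N K N0 KN p sp i.
have [p0 pv p1 _] := sp.
have es : in_simplex (expected_M p).
  split=> [k|].
    by apply: sumr_ge0 => x _; rewrite mulr_ge0 // divr_ge0.
  rewrite /expected_M exchange_big -[RHS]p1; apply: eq_bigr => x _ /=.
  have [vx|nvx] := boolP (valid_config x); last first.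
    by rewrite pv // big1 // => k _; rewrite mul0r.
  by rewrite -mulr_sumr (empirical_simplex R N0 vx).2 mulr1.
have [MN|NM] := leqP (M ^ 2)%N N; last first.
  apply: (@le_trans _ _ 1).
    have [e0 m0] := (es.1 i, sm.1 i).
    have [e1 m1] := (simplex_le1 i es, simplex_le1 i sm).
    by rewrite ler_norml; apply/andP; split; lra.
  apply: (@le_trans _ _ (b2 * expR (- (c * N%:R)))).
    rewrite -expRD -[leLHS]expR0 ler_expR -mulrBr mulr_ge0 ?(ltW c_gt0) //.
    by rewrite subr_ge0 -natrX ler_nat ltnW.
  by rewrite ler_wpM2r ?expR_ge0 // lerDr.
pose bad (x : config d N) := ~~ `[< forall k, `|empirical R x k - mstar k| <= r >].
have pbad : \sum_x p x * (bad x)%:R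
    <= L%:R * (2 * d%:R * expR (- (N%:R / (8 * M%:R ^+ 3)))).
  apply: (stationary_batch_le g0 g1 N0 KN M0 MN sp) => x y vx vy.
  move=> /(reach_pseudo g0 g1 N0 M0 vx) [u [pu _ uL]].
  by rewrite negbK; apply/asboolP => k; rewrite -uL; exact: hL.
have [j hj] := hc0 _ es.
have /(_ i) {}hj := hj.
(* Subtract the stationary mean of the true drift, which is 0; the two drifts differ only at bad
   configurations. *)
have ad : `|adrift Q0 Q1 alpha s (expected_M p) j|
    <= 3 * Lam Q0 Q1 * \sum_x p x * (bad x)%:R.
  have -> : adrift Q0 Q1 alpha s (expected_M p) j
     = \sum_x p x * (adrift Q0 Q1 alpha s (empirical R x) j
                     - drift Q0 Q1 alpha (empirical R x) j).
    under eq_bigr do rewrite mulrBr.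
    by rewrite sumrB (stationary_drift _ _ _ N0 KN sp) // subr0 -adrift_avg.
  apply: le_trans (ler_norm_sum _ _ _) _; rewrite mulr_sumr; apply: ler_sum => x _.
  rewrite normrM ger0_norm // mulrCA.
  have [vx|nvx] := boolP (valid_config x); last by rewrite pv // !mul0r.
  have sx := empirical_simplex R N0 vx; rewrite ler_wpM2l //.
  rewrite /bad; case: asboolP => [hx|_] /=.
    by rewrite haff // subrr normr0 mulr0.
  rewrite mulr1 (_ : 3 * _ = 2 * Lam Q0 Q1 + Lam Q0 Q1); last by ring.
  by rewrite (le_trans (ler_normB _ _)) // lerD ?adrift_bound ?drift_bound.
apply: (@le_trans _ _ (b1 * expR (- (c * N%:R)))); last first.
  by rewrite ler_wpM2r ?expR_ge0 // lerDl expR_ge0.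
rewrite -(ler_pM2l c00); apply: le_trans hj (le_trans ad _).
apply: le_trans (ler_wpM2l _ pbad) _; first by rewrite mulr_ge0 // ltW.
rewrite /b1 /c (_ : 1 / _ * N%:R = N%:R / (8 * M%:R ^+ 3)); last by rewrite mul1r mulrC.
rewrite le_eqVlt; apply/orP; left; apply/eqP; field; exact: lt0r_neq0.
Qed.
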